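(* Let $1\le p,q\le\infty$ (with the convention $1/\infty=0$). Consider $L_q$-approximation on $[0,1]$ of functions from the unit ball of $W^1_p([0,1])$. For $n\in\mathbb{N}$, let $x_1,\dots,x_n$ be independent and uniformly distributed in $[0,1]$ and let $N_n(f)=(f(x_1),\dots,f(x_n))$. Then, for $n\ge 2$, $$ \mathbb{E}[r(N_n)]\asymp \begin{cases} r(N_n^* )\asymp n^{-1} & \text{if } p>q,\\[2mm] r(N^*_{n/\log n})\asymp\left(\dfrac{n}{\log n}\right)^{-1+1/p-1/q} & \text{if } p\le q. \end{cases} $$
   Context: The Sobolev space $W^1_p([0,1])$ is normed by $\|f\|_{W^1_p([0,1])}=(\|f\|_p^p+\|f'\|_p^p)^{1/p}$ (usual modification for $p=\infty$), where $\|\cdot\|_p$ is the $L_p([0,1])$-norm; its elements are identified with their continuous representatives. Let $F=\{f\in W^1_p([0,1]):\|f\|_{W^1_p([0,1])}\le 1\}$. For points $x_1,\dots,x_n\in[0,1]$ and the information mapping $N_n(f)=(f(x_1),\dots,f(x_n))$, the radius of information is $$r(N_n)=\inf_{\phi:\mathbb{R}^n\to L_q([0,1])}\ \sup_{f\in F}\|f-\phi(N_n(f))\|_q ,$$ where the infimum is over all mappings $\phi$. The radius of optimal information is $r(N_n^* )=\inf_{N_n} r(N_n)$, the infimum being over all choices of $n$ points $x_1,\dots,x_n\in[0,1]$ (deterministic). $N^*_{n/\log n}$ denotes optimal information using $n/\log n$ function values (rounded down to an integer), and $\log$ is the natural logarithm. For sequences of positive reals, $a_n\asymp b_n$ means that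 there are constants $c,C\in(0,\infty)$, independent of $n$ (they may depend on $p,q$), with $c\,b_n\le a_n\le C\,b_n$ for all $n$ considered. *)

(* Defs.v *)
From HB Require Import structures.
From mathcomp Require Import all_boot all_order all_algebra.
From mathcomp Require Import all_classical all_reals all_analysis.

Set Implicit Arguments.
Unset Strict Implicit.
Unset Printing Implicit Defensive.

Import Order.TTheory GRing.Theory Num.Theory.
Import numFieldNormedType.Exports.

Local Open Scope classical_set_scope.
Local Open Scope ring_scope.

(* Functions on [0, 1] are represented by functions R -> R whose values outside
   [0, 1] are irrelevant: norms and integrals use the measure leb01, points of
   evaluation lie in [0, 1]. *)
Definition leb01 (R : realType) : {measure set (measurableTypeR R) -> \bar R} :=
  mrestr (@lebesgue_measure R) (measurable_itv `[0, 1]).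

Definition Lp_norm (R : realType) (p : \bar R) (f : R -> R) : \bar R :=
  'N[@leb01 R]_p[EFin \o f]%E.

(* The class C^1_c(]0, 1[): the support is closed and contained in ]0, 1[, hence
   compact. Weak derivatives tested against C^1_c functions, as in Brezis'
   "Functional Analysis, Sobolev Spaces and PDE", agree with those tested
   against smooth compactly supported functions. *)
Definition test_function (R : realType) (phi : R -> R) : Prop :=
  [/\ forall x, derivable phi x 1,
      continuous (derive1 phi) &
      closure [set x | phi x != 0] `<=` `]0, 1[].

Definition weak_derivative (R : realType) (f g : R -> R) : Prop :=
  forall phi : R -> R, test_function phi ->
    \int[@leb01 R]_x (f x * derive1 phi x) = - \int[@leb01 R]_x (g x * phi x).

(* f is the continuous representative of an element of W^1_p([0, 1]) and g is
   one of its (almost everywhere equal) weak derivatives. *)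
Definition sobolev_with_derivative (R : realType) (p : \bar R) (f g : R -> R)
    : Prop :=
  [/\ f \in Lfun (@leb01 R) p,
      {within `[0, 1], continuous f},
      g \in Lfun (@leb01 R) p &
      weak_derivative f g].

(* Meant for 1 <= p <= +oo; the second branch is then the case p = +oo. *)
Definition sobolev_norm (R : realType) (p : \bar R) (f g : R -> R) : \bar R :=
  (if p is r%:E then (Lp_norm p f `^ r + Lp_norm p g `^ r) `^ r^-1
   else maxe (Lp_norm p f) (Lp_norm p g))%E.

Definition sobolev_ball (R : realType) (p : \bar R) : set (R -> R) :=
  [set f | exists2 g, sobolev_with_derivative p f g &
                      (sobolev_norm p f g <= 1)%E].

Definition information (R : realType) (n : nat) (x : 'I_n -> R) (f : R -> R)
    : 'rV[R]_n :=
  \row_i f (x i).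

Definition radius_of_information (R : realType) (p q : \bar R) (n : nat)
    (x : 'I_n -> R) : \bar R :=
  ereal_inf
    [set ereal_sup [set Lp_norm q (f \- phi (information x f))
                   | f in sobolev_ball p]
    | phi in [set phi : 'rV[R]_n -> R -> R |
              forall y, phi y \in Lfun (@leb01 R) q]].

Definition optimal_radius (R : realType) (p q : \bar R) (n : nat) : \bar R :=
  ereal_inf
    [set radius_of_information p q x
    | x in [set x : 'I_n -> R | forall i, x i \in `[0, 1]]].

Definition mutually_independent d (T : measurableType d) (R : realType)
    (P : probability T R) (n : nat) (X : 'I_n -> {RV P >-> R}) : Prop :=
  forall (J : {set 'I_n}) (A : 'I_n -> set R), (forall i, measurable (A i)) ->
    P (\bigcap_(i in [set` J]) X i @^-1` A i) =
    (\prod_(i in J) P (X i @^-1` A i))%E.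

Definition iid_uniform d (T : measurableType d) (R : realType)
    (P : probability T R) (n : nat) (X : 'I_n -> {RV P >-> R}) : Prop :=
  mutually_independent X /\
  forall i (A : set R), measurable A ->
    distribution P (X i) A = uniform_prob (@ltr01 R) A.

(* The X i are independent and uniform, so they lie in [0, 1] almost surely; the
   value of the radius at other points does not affect the integral. *)
Definition expected_radius d (T : measurableType d) (R : realType)
    (P : probability T R) (p q : \bar R) (n : nat) (X : 'I_n -> {RV P >-> R})
    : \bar R :=
  (\int[P]_w radius_of_information p q (fun i => X i w))%E.

Definition between_multiples (R : realType) (c C : R) (a b : \bar R) : Prop :=
  (c%:E * b <= a)%E /\ (a <= C%:E * b)%E.

(* Main.v *)
(** Cut [0, 1] into m bins of equal length. For f in the ball with weak
    derivative g, |f s - f t| is at most the integral of |g| over [s, t]; testing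
    against C^1 plateaus supported in [s, t] shows this directly. Hence every
    sampled value approximates f on its bin up to local integrals of |g|, and
    Hoelder on the bins turns ||g||_p <= 1 into the upper bounds: m^(-1+1/p-1/q)
    when p <= q and every bin contains a point, and, when q < p, m^(-1) times
    an average of powers of the distances, in bins, to the nearest occupied bin.
    Conversely, a sum of C^1 bells over a set S of bins without points, together
    with its opposite, is not seen by the information; this bounds the radius
    below by a multiple of m^(-1) (|S|/m)^(1/q-1/p).
    A set of s bins contains no random point with probability (1 - s/m)^n. For
    q < p take m = n: runs of empty bins have exponential tails, so the average
    above has bounded expectation. For p <= q the coupon collector threshold
    m ~ n / log n is decisive: with few enough bins all of them are hit except
    with probability O(1/n), while with slightly more bins some bin stays empty
    with probability at least 1/2 by the second moment method. *)

Require Import Defs.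
From HB Require Import structures.
From mathcomp Require Import all_boot all_order all_algebra.
From mathcomp Require Import all_classical all_reals all_analysis.
From mathcomp Require Import ess_sup_inf measurable_realfun ring lra zify.

Set Implicit Arguments.
Unset Strict Implicit.
Unset Printing Implicit Defensive.

Import Order.TTheory GRing.Theory Num.Theory.
Import numFieldNormedType.Exports.

Local Open Scope classical_set_scope.
Local Open Scope ring_scope.

(** * Bins of the unit interval *)

(** The supremum over [f] stands inside the expectation, so for q < p the error must first be
    bounded by a quantity from which [f] has disappeared. [powR_tradeoff] does this: it splits each
    product of a local integral of |g| and a gap length into a part with bounded sum and a power of
    the gap length alone. The size of that power does not matter, since gaps in units of 1/n have
    all moments bounded. All of the probability rests on the exact value of [P (miss S)]: the radius
    is compared pointwise with finite combinations of indicators of such events, with the trivial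
    bound 4 on the bad ones. For p <= q the bad event costs a multiple of log n / n, which is
    admissible because -1 + 1/p - 1/q lies in [-1, 0]; for the same reason a constant factor in the
    number of bins costs only a constant factor. One lower bound serves both regimes: bells over
    bins of total measure mu may have slope of order mu^(-1/p). A single empty bin is the best
    choice for p <= q, half of all bins for q < p. *)

Section unit_interval_measure.
Context {R : realType}.
Implicit Types (f : R -> \bar R) (a b : R).
Local Notation mu := (@lebesgue_measure R).
Local Notation nu := (@leb01 R).

Lemma leb01_itv a b (l r : bool) : 0 <= a -> a < b -> b <= 1 ->
  nu [set` Interval (BSide l a) (BSide r b)] = (b - a)%:E.
Proof.
move=> a0 ab b1; rewrite /leb01 /= /mrestr setIidl.
  by rewrite lebesgue_measure_itv/= lte_fin ab.
move=> x /=; rewrite !in_itv/= => /andP[h1 h2]; apply/andP; split.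
  by case: l h1 => /=; lra.
by case: r h2 => /=; lra.
Qed.

Lemma leb01T : nu setT = 1%E.
Proof.
by rewrite /leb01 /= /mrestr setTI lebesgue_measure_itv/= lte_fin ltr01 sube0.
Qed.

Lemma leb01_fin A : measurable A -> (nu A < +oo)%E.
Proof.
move=> mA; apply: (@le_lt_trans _ _ (nu setT)); last by rewrite leb01T ltry.
by apply: le_measure; rewrite ?inE.
Qed.

Lemma integral_leb01_in (D : set R) f : measurable D -> D `<=` `[0, 1] ->
  (\int[nu]_(x in D) f x = \int[mu]_(x in D) f x)%E.
Proof.
move=> mD D01; apply: eq_measure_integral => A mA AD.
by rewrite /leb01 /= /mrestr setIidl//; exact: subset_trans D01.
Qed.

Lemma ge0_integral_leb01 f : measurable_fun setT f -> (forall x, 0 <= f x)%E ->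
  (\int[nu]_x f x = \int[mu]_(x in `[0%R, 1%R]) f x)%E.
Proof.
move=> mf f0; rewrite -integral_leb01_in//.
rewrite (@ge0_negligible_integral _ _ _ nu setT (~` `[0, 1]))//.
- by rewrite setTD setCK.
- by apply: measurableC.
- by rewrite /leb01 /= /mrestr setICl measure0.
Qed.

Lemma integral_leb01 f : measurable_fun setT f ->
  (\int[nu]_x f x = \int[mu]_(x in `[0%R, 1%R]) f x)%E.
Proof.
move=> mf; rewrite integralE [in RHS]integralE.
by rewrite !ge0_integral_leb01//; [exact: measurable_funeneg|
  exact: measurable_funepos].
Qed.

Lemma leb01_ae_eq0 (N : set R) : measurable N -> nu (~` N) = 1%E ->
  nu N = 0%E.
Proof.
move=> mN N1; have : (nu (N `|` ~` N) = nu N + nu (~` N))%E.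
  by rewrite measureU//; [exact: measurableC|rewrite setICr].
rewrite setUCr leb01T N1.
have : nu N \is a fin_num by rewrite ge0_fin_numE// leb01_fin.
case: (nu N) => [r||]// _; rewrite -EFinD => -[] /eqP.
by rewrite -subr_eq subrr => /eqP <-.
Qed.

End unit_interval_measure.

(* The integral of a nonnegative function is the supremum of the integrals of the
   simple functions below it, so no measurability is required; the radius is not
   known to be a measurable function of the points. *)
Lemma lower_integral_le d (T : measurableType d) (R : realType)
    (P : {measure set T -> \bar R}) (f g : T -> \bar R) :
  (forall x, 0 <= f x)%E -> (forall x, f x <= g x)%E ->
  (\int[P]_x f x <= \int[P]_x g x)%E.
Proof.
move=> f0 fg; rewrite !ge0_integralTE//; last first.
  by move=> x; exact: le_trans (fg x).
apply: le_ereal_sup => _ [h /= hf <-]; exists h => //= x.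
exact: le_trans (fg x).
Qed.

Section bins.
Context {R : realType}.
Local Notation nu := (@leb01 R).

(** Open bins lie strictly inside ]0, 1[, where plateau test functions are available. A bell on a
    bin vanishes at its endpoints, so a sample on the boundary of a bin rightly counts as outside.
    The omitted points j / m form a null set. *)
Definition bin m (j : nat) : set R := `]j%:R / m%:R, j.+1%:R / m%:R[.

Lemma measurable_bin m j : measurable (bin m j).
Proof. exact: measurable_itv. Qed.

Lemma binP m (j : nat) (t : R) : (0 < m)%N ->
  bin m j t <-> j%:R < m%:R * t < j.+1%:R.
Proof.
move=> m0; rewrite /bin /= in_itv/= ltr_pdivrMr ?ltr0n// ltr_pdivlMr ?ltr0n//.
by rewrite mulrC.
Qed.

Lemma bin01 m j t : (j < m)%N -> bin m j t -> 0 < t < 1.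
Proof.
move=> jm; have m0 : (0 < m)%N by exact: leq_trans jm.
move=> /(binP _ _ m0)/andP[h1 h2].
have : (j.+1%:R <= m%:R :> R) by rewrite ler_nat.
have : (0 <= j%:R :> R) by [].
have : (0 < m%:R :> R) by rewrite ltr0n.
move=> a b c; apply/andP; split; nra.
Qed.

Lemma bin_inj m (j k : nat) t : (0 < m)%N -> bin m j t -> bin m k t -> j = k.
Proof.
move=> m0 /(binP _ _ m0)/andP[a b] /(binP _ _ m0)/andP[c d].
have := lt_trans a d; have := lt_trans c b; rewrite !ltr_nat.
lia.
Qed.

Lemma leb01_bin m j : (j < m)%N -> nu (bin m j) = (m%:R^-1)%:E.
Proof.
move=> jm; have m0 : (0 < m)%N by exact: leq_trans jm.
have m0' : (0 < m%:R :> R) by rewrite ltr0n.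
rewrite /bin leb01_itv//.
- by congr EFin; rewrite -mulrBl -natrB// subSnn mul1r.
- by rewrite ltr_pM2r ?invr_gt0// ltr_nat.
- by rewrite ler_pdivrMr// mul1r ler_nat.
Qed.

Lemma trivIset_bin m (A : set 'I_m) : trivIset A (fun j : 'I_m => bin m j).
Proof.
move=> j k _ _ [t [jt kt]]; apply/val_inj.
by apply: (@bin_inj m _ _ t) => //; apply: (leq_trans _ (ltn_ord j)).
Qed.

Definition bins m (S : {set 'I_m}) : set R := \big[setU/set0]_(j in S) bin m j.

Lemma binsP m (S : {set 'I_m}) t :
  bins S t <-> exists2 j, j \in S & bin m j t.
Proof.
rewrite /bins -bigcup_seq_cond/=; split => [[j /=]|[j jS jt]].
  by move=> /andP[_ jS]; exists j.
by exists j => //=; rewrite mem_index_enum.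
Qed.

Lemma measurable_bins m (S : {set 'I_m}) : measurable (bins S).
Proof. by apply: bigsetU_measurable => j _; exact: measurable_bin. Qed.

Lemma ge0_integral_bins m (S : {set 'I_m}) (f : R -> \bar R) :
  measurable_fun setT f -> (forall x, 0 <= f x)%E ->
  (\int[nu]_(x in bins S) f x = \sum_(j in S) \int[nu]_(x in bin m j) f x)%E.
Proof.
move=> mf f0; rewrite /bins -!big_enum/= ge0_integral_bigsetU//.
- by move=> j; exact: measurable_bin.
- exact: enum_uniq.
- exact: trivIset_bin.
- exact: measurable_funS mf.
Qed.

Lemma leb01_bins m (S : {set 'I_m}) : nu (bins S) = (#|S|%:R / m%:R)%:E.
Proof.
have := @ge0_integral_bins m S (cst 1%E).
rewrite integral_cst ?mul1e; last exact: measurable_bins.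
move=> -> //; rewrite (eq_bigr (fun=> (m%:R^-1)%:E)).
  by rewrite sumEFin sumr_const mulr_natl.
by move=> j _; rewrite integral_cst ?mul1e ?leb01_bin//; exact: measurable_bin.
Qed.

Lemma leb01_setC_bins m : (0 < m)%N -> nu (~` bins [set: 'I_m]) = 0%E.
Proof.
move=> m0; apply: leb01_ae_eq0.
  by apply: measurableC; exact: measurable_bins.
rewrite setCK leb01_bins cardsT card_ord divff//.
by rewrite pnatr_eq0 -lt0n.
Qed.

Lemma ge0_integral_leb01_sum m (f : R -> \bar R) : (0 < m)%N ->
  measurable_fun setT f -> (forall x, 0 <= f x)%E ->
  (\int[nu]_x f x = \sum_(j < m) \int[nu]_(x in bin m j) f x)%E.
Proof.
move=> m0 mf f0.
transitivity (\sum_(j in [set: 'I_m]%SET) \int[nu]_(x in bin m j) f x)%E.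
  rewrite -ge0_integral_bins//.
  rewrite (@ge0_negligible_integral _ _ _ nu setT (~` bins [set: 'I_m]))//.
  - by rewrite setTD setCK.
  - by apply: measurableC; exact: measurable_bins.
  - exact: leb01_setC_bins.
by apply: eq_bigl => j; rewrite inE.
Qed.

End bins.

(** * Increments of functions with a weak derivative *)

Section quadratic_bumps.
Context {R : realType}.
Local Notation mu := (@lebesgue_measure R).
Local Notation nu := (@leb01 R).

Implicit Types u a e t : R.

Definition posr (u : R) : R := Num.max 0 u.

Lemma posr_ge0 u : 0 <= posr u. Proof. by rewrite /posr le_max lexx. Qed.

Lemma posr_id u : 0 <= u -> posr u = u.
Proof. by move=> u0; rewrite /posr max_r. Qed.

Lemma posr0 u : u <= 0 -> posr u = 0.
Proof. by move=> u0; rewrite /posr max_l. Qed.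

Lemma posr_case u : (posr u = 0 /\ u <= 0) \/ (posr u = u /\ 0 <= u).
Proof. by have [u0|/ltW u0] := lerP 0 u; [right; rewrite posr_id|left; rewrite posr0]. Qed.

Lemma continuous_posr : continuous posr.
Proof. by move=> x; apply: (@continuous_max R R (cst 0) id); [exact: cvg_cst|exact: cvg_id]. Qed.

(** The difference quotient is off by at most C |h|. For the square of [posr] this treats the kink
    at 0 and all other points alike. *)
Lemma is_derive_quadratic (F : R -> R) (u l C : R) :
  (forall h, `|F (u + h) - F u - h * l| <= C * h ^+ 2) -> is_derive u 1 F l.
Proof.
move=> H; have C0 : 0 <= C by have := le_trans (normr_ge0 _) (H 1); lra.
suff c : h^-1 *: (F (h *: 1 + u) - F u) @[h --> 0^'] --> l.
  by apply: DeriveDef; [apply/cvg_ex; exists l|exact/cvg_lim].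
apply/cvgrPdist_le => e e0; near=> h.
have h0 : h != 0 by near: h; exact: nbhs_dnbhs_neq.
rewrite [h *: 1]mulr1 [_ *: _]mulrC.
rewrite [leLHS](_ : _ = `|F (u + h) - F u - h * l| / `|h|); last first.
  rewrite -normfV -normrM distrC (addrC u); congr `|_|.
  by field.
rewrite ler_pdivrMr ?normr_gt0//; apply: (le_trans (H h)).
rewrite -[h ^+ 2]real_normK ?num_real// expr2 mulrA ler_wpM2r//.
apply: (@le_trans _ _ ((C + 1) * `|h|)); first by rewrite ler_wpM2r// lerDl.
rewrite -ler_pdivlMl; last by rewrite ltr_wpDl.
by near: h; apply: dnbhs0_le; rewrite mulr_gt0// invr_gt0 ltr_wpDl.
Unshelve. all: by end_near. Qed.

Lemma is_derive_sqr_posr (u : R) : is_derive u 1 (fun x => posr x ^+ 2) (2 * posr u).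
Proof.
apply: (@is_derive_quadratic _ _ _ 1) => h; rewrite mul1r ler_norml.
by have [[-> ?]|[-> ?]] := posr_case (u + h);
  have [[-> ?]|[-> ?]] := posr_case u; apply/andP; split; nra.
Qed.

(* smooth_step a e is C^1, vanishes before a, equals 1 after a + e, and has the
   tent function hat a e as its derivative. *)
Definition smooth_step (a e t : R) : R := 2 / e ^+ 2 *
  (posr (t - a) ^+ 2 - 2 * posr (t - (a + e / 2)) ^+ 2 + posr (t - (a + e)) ^+ 2).

Definition hat (a e t : R) : R := 4 / e ^+ 2 *
  (posr (t - a) - 2 * posr (t - (a + e / 2)) + posr (t - (a + e))).

Lemma is_derive_smooth_step (a e t : R) : is_derive t 1 (smooth_step a e) (hat a e t).
Proof.
have D c : is_derive t 1 (fun x => posr (x - c) ^+ 2) (2 * posr (t - c)).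
  rewrite -[X in is_derive _ _ _ X]mulr1.
  apply: (@is_derive1_comp _ (fun x => posr x ^+ 2) (fun x => x - c)).
    exact: is_derive_sqr_posr.
  by apply: is_derive_eq; rewrite subr0.
have -> : smooth_step a e = (2 / e ^+ 2) \*: ((fun x => posr (x - a) ^+ 2)
    - 2 \*: (fun x => posr (x - (a + e / 2)) ^+ 2)
    + (fun x => posr (x - (a + e)) ^+ 2)) by [].
by apply: is_derive_eq; rewrite /hat /GRing.scale/=; ring.
Qed.

Lemma continuous_hat a e : continuous (hat a e).
Proof.
move=> t; have C c : {for t, continuous (fun x => posr (x - c))}.
  apply: continuous_comp; last exact: continuous_posr.
  by apply: cvgB; [exact: cvg_id|exact: cvg_cst].
apply: cvgM; first exact: cvg_cst.
apply: cvgD; last exact: C.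
by apply: cvgB; [exact: C|apply: cvgM; [exact: cvg_cst|exact: C]].
Qed.

Lemma hat_ge0 a e t : 0 < e -> 0 <= hat a e t.
Proof.
move=> e0; rewrite /hat mulr_ge0//; first by rewrite divr_ge0// exprn_ge0// ltW.
by have [[-> ?]|[-> ?]] := posr_case (t - a);
  have [[-> ?]|[-> ?]] := posr_case (t - (a + e / 2));
  have [[-> ?]|[-> ?]] := posr_case (t - (a + e)); lra.
Qed.

Lemma hat_out a e t : 0 < e -> (t <= a) || (a + e <= t) -> hat a e t = 0.
Proof.
move=> e0 ta; rewrite /hat [X in _ * X](_ : _ = 0) ?mulr0//.
have [ta1|ta1] := orP ta; first by rewrite !posr0//; lra.
by rewrite !posr_id//; lra.
Qed.

Lemma smooth_step_le a e t : 0 < e -> t <= a -> smooth_step a e t = 0.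
Proof.
by move=> e0 ta; rewrite /smooth_step !posr0; [rewrite expr0n/=; ring|lra..].
Qed.

Lemma smooth_step_ge a e t : 0 < e -> a + e <= t -> smooth_step a e t = 1.
Proof.
by move=> e0 ta; rewrite /smooth_step !posr_id; [field; rewrite gt_eqF|lra..].
Qed.

Lemma smooth_step01 a e t : 0 < e -> 0 <= smooth_step a e t <= 1.
Proof.
move=> e0.
pose s := posr (t - a) ^+ 2 - 2 * posr (t - (a + e / 2)) ^+ 2 +
  posr (t - (a + e)) ^+ 2.
suff /andP[s0 s1] : 0 <= s <= e ^+ 2 / 2.
  have -> : smooth_step a e t = s / (e ^+ 2 / 2).
    by rewrite /smooth_step -/s; field; rewrite gt_eqF.
  have ee : 0 < e ^+ 2 / 2 by rewrite divr_gt0// exprn_gt0.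
  by rewrite divr_ge0 ?(ltW ee)//= ler_pdivrMr// mul1r.
rewrite /s.
by have [[-> ?]|[-> ?]] := posr_case (t - a);
  have [[-> ?]|[-> ?]] := posr_case (t - (a + e / 2));
  have [[-> ?]|[-> ?]] := posr_case (t - (a + e)); apply/andP; split; nra.
Qed.

Lemma continuous_smooth_step a e : continuous (smooth_step a e).
Proof.
move=> t; apply: differentiable_continuous; apply/derivable1_diffP.
by case: (is_derive_smooth_step a e t).
Qed.

Lemma hat_bounded a e t : 0 < e -> hat a e t <= 2 / e.
Proof.
move=> e0; rewrite /hat.
have -> : 2 / e = 4 / e ^+ 2 * (e / 2) by field; rewrite gt_eqF.
rewrite ler_wpM2l//; first by rewrite divr_ge0// exprn_ge0// ltW.
by have [[-> ?]|[-> ?]] := posr_case (t - a);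
  have [[-> ?]|[-> ?]] := posr_case (t - (a + e / 2));
  have [[-> ?]|[-> ?]] := posr_case (t - (a + e)); lra.
Qed.

Lemma measurable_hat a e : measurable_fun setT (hat a e).
Proof. by apply: continuous_measurable_fun; exact: continuous_hat. Qed.

Lemma Rintegral_hat a e : 0 <= a -> 0 < e -> a + e <= 1 ->
  nu.-integrable setT (EFin \o hat a e) /\ \int[nu]_t hat a e t = 1.
Proof.
move=> a0 e0 ae1.
have i1 : (\int[nu]_t (hat a e t)%:E = 1)%E.
  rewrite integral_leb01; last by apply/measurable_EFinP; exact: measurable_hat.
  rewrite (@continuous_FTC2 _ (hat a e) (smooth_step a e))//.
  - by rewrite smooth_step_ge// smooth_step_le// sube0.
  - by apply: continuous_subspaceT; exact: continuous_hat.
  - split.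
    + by move=> x _; case: (is_derive_smooth_step a e x).
    + by apply: cvg_at_right_filter; exact: continuous_smooth_step.
    + by apply: cvg_at_left_filter; exact: continuous_smooth_step.
  - by move=> x _; rewrite derive1E; case: (is_derive_smooth_step a e x).
split; last by rewrite /Rintegral i1.
apply/integrableP; split; first by apply/measurable_EFinP; exact: measurable_hat.
under eq_integral do rewrite /= ger0_norm ?hat_ge0//.
by rewrite i1 ltry.
Qed.

End quadratic_bumps.

(** * Increments bounded by integrals of the weak derivative *)

Section weak_derivative_increment.
Context {R : realType}.
Local Notation nu := (@leb01 R).
Implicit Types (f g : R -> R) (x y e t : R).

Lemma derive1_plateau x y e :
  derive1 (fun t => smooth_step x e t - smooth_step y e t) = (fun t => hat x e t - hat y e t).
Proof.
apply/funext => t; rewrite derive1E.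
have -> : (fun t => smooth_step x e t - smooth_step y e t) = smooth_step x e - smooth_step y e by [].
have := is_derive_smooth_step x e t; have := is_derive_smooth_step y e t => d1 d2.
by have [_ ->] := is_deriveB d2 d1.
Qed.

Lemma test_function_plateau x y e : 0 < x -> 0 < e -> x <= y -> y + e < 1 ->
  test_function (fun t => smooth_step x e t - smooth_step y e t).
Proof.
move=> x0 e0 xy y1; split.
- move=> t; have := is_derive_smooth_step x e t; have := is_derive_smooth_step y e t => d1 d2.
  by have [] := is_deriveB d2 d1.
- by rewrite derive1_plateau => t; apply: cvgB; exact: continuous_hat.
- apply: (@subset_trans _ `[x, y + e]); last first.
    by move=> t /=; rewrite !in_itv/=; lra.
  rewrite [X in _ `<=` X](closure_id _).1; last exact: itv_closed.
  apply: closure_subset => t /=; rewrite in_itv/= => h.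
  apply/andP; split; rewrite leNgt; apply: contra h => h; apply/eqP.
    by rewrite !smooth_step_le//; lra.
  by rewrite !smooth_step_ge//; lra.
Qed.

Lemma bounded_hat x e (A : set R) : 0 < e -> [bounded hat x e t | t in A].
Proof.
move=> e0; exists (2 / e); split; first exact: num_real.
move=> M HM t _ /=; rewrite ger0_norm ?hat_ge0//.
by apply: (le_trans (hat_bounded _ _ _)) => //; exact: ltW.
Qed.

(** The test function is a plateau that rises on [x, x + e] and falls on [y - e, y]. Its derivative
    is a difference of two tents of mass 1, so by continuity the left side of [weak_derivative] is f
    x - f y up to eta. The plateau takes values in [0, 1] and vanishes off [x, y], which bounds the
    right side by the integral of |g|. *)
Lemma weak_derivative_decrement f g x y : 0 < x -> x < y -> y < 1 ->
  {within `[0, 1], continuous f} ->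
  nu.-integrable setT (EFin \o f) -> nu.-integrable setT (EFin \o g) ->
  weak_derivative f g -> f x - f y <= \int[nu]_(t in `[x, y]) `|g t|.
Proof.
move=> x0 xy y1 cf intf intg wd; apply/ler_addgt0Pr => eta eta0.
have [cf' _ _] := (continuous_within_itvP f (@ltr01 R)).1 cf.
have cvx : f t @[t --> x] --> f x by apply: cf'; rewrite in_itv/=; lra.
have cvy : f t @[t --> y] --> f y by apply: cf'; rewrite in_itv/=; lra.
have eta2 : 0 < eta / 2 by lra.
have /cvgrPdist_le/(_ _ eta2)/nbhs_ballP[dx /= dx0 Hx] := cvx.
have /cvgrPdist_le/(_ _ eta2)/nbhs_ballP[dy /= dy0 Hy] := cvy.
(* Half the length keeps the two ramps from overlapping; [dx] and [dy] keep f within eta / 2 of its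
   endpoint values on them. *)
have [e [e0 exy ex ey]] : exists e, [/\ 0 < e, e <= (y - x) / 2, e < dx & e < dy].
  exists (Num.min ((y - x) / 2) (Num.min (dx / 2) (dy / 2))).
  by rewrite !lt_min !ge_min !gt_min; split; rewrite ?lexx//=; lra.
have {}Hx t : x <= t <= x + e -> f x - eta / 2 <= f t.
  move=> tx; have := Hx t; rewrite /ball/= ltr_norml ler_norml; lra.
have {}Hy t : y - e <= t <= y -> f t <= f y + eta / 2.
  move=> ty; have := Hy t; rewrite /ball/= ltr_norml ler_norml; lra.
pose z := y - e.
have zE : z + e = y by rewrite /z; ring.
have xz : x + e <= z by rewrite /z; lra.
have [ibx Ibx] : nu.-integrable setT (EFin \o hat x e) /\
  \int[nu]_t hat x e t = 1 by apply: Rintegral_hat; lra.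
have [ibz Ibz] : nu.-integrable setT (EFin \o hat z e) /\
  \int[nu]_t hat z e t = 1 by apply: Rintegral_hat; lra.
have tf : test_function (fun t => smooth_step x e t - smooth_step z e t).
  by apply: test_function_plateau; lra.
have mD : measurable_fun setT (fun t => hat x e t - hat z e t).
  by apply: measurable_funB; exact: measurable_hat.
have /= := wd _ tf; rewrite derive1_plateau => wdE.
have low : f x - eta / 2 - (f y + eta / 2) <=
    \int[nu]_t (f t * (hat x e t - hat z e t)).
  have i1 : nu.-integrable setT (EFin \o (fun t => (f x - eta / 2) * hat x e t)).
    exact: (integrableZl measurableT _ ibx).
  have i2 : nu.-integrable setT (EFin \o (fun t => (f y + eta / 2) * hat z e t)).
    exact: (integrableZl measurableT _ ibz).
  have -> : f x - eta / 2 - (f y + eta / 2) = \int[nu]_t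
      ((f x - eta / 2) * hat x e t - (f y + eta / 2) * hat z e t).
    by rewrite RintegralB// RintegralZl// RintegralZl// Ibx Ibz !mulr1.
  apply: (@le_Rintegral _ _ _ nu setT) => //.
  - exact: (integrableB measurableT i1 i2).
  - apply: (@integrableMl _ _ _ nu _ measurableT (EFin \o f)) => //.
    by apply: bounded_funD; [|apply: bounded_funN]; exact: bounded_hat.
  - move=> t _; have bx := hat_ge0 x t e0; have bz := hat_ge0 z t e0.
    have h1 : (f x - eta / 2) * hat x e t <= f t * hat x e t.
      have [tx|tx] := boolP (x <= t <= x + e); first by rewrite ler_wpM2r// Hx.
      by rewrite hat_out ?mulr0//; lra.
    have h2 : f t * hat z e t <= (f y + eta / 2) * hat z e t.
      have [tx|tx] := boolP (z <= t <= z + e).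
        by rewrite ler_wpM2r// Hy// -/z -zE.
      by rewrite hat_out ?mulr0//; lra.
    lra.
have gphi : nu.-integrable setT
    (EFin \o (fun t => g t * (smooth_step x e t - smooth_step z e t))).
  apply: (@integrableMl _ _ _ nu _ measurableT (EFin \o g)) => //.
    by apply: continuous_measurable_fun => t; apply: cvgB; exact: continuous_smooth_step.
  exists 1; split; first exact: num_real.
  move=> M M1 t _ /=; have := smooth_step01 x t e0; have := smooth_step01 z t e0.
  rewrite ler_norml; lra.
have up : - (\int[nu]_t (g t * (smooth_step x e t - smooth_step z e t))) <=
    \int[nu]_(t in `[x, y]) `|g t|.
  apply: (@le_trans _ _ (\int[nu]_t `|g t * (smooth_step x e t - smooth_step z e t)|)).
    apply: le_trans (ler_norm _) _; rewrite normrN.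
    exact: (le_normr_Rintegral measurableT gphi).
  rewrite [leRHS]Rintegral_mkcond; apply: (@le_Rintegral _ _ _ nu setT) => //.
  - exact: (integrable_norm gphi).
  - rewrite -restrict_EFin; apply/integrable_restrict => //; rewrite setTI.
    apply: (@integrableS _ _ _ nu setT) => //.
    exact: (integrable_norm intg).
  - move=> t _; rewrite patchE; case: ifPn => [_|].
      rewrite normrM ler_piMr// ler_norml.
      have := smooth_step01 x t e0; have := smooth_step01 z t e0; lra.
    rewrite notin_setE/= in_itv/= => txy.
    suff -> : smooth_step x e t = smooth_step z e t by rewrite subrr mulr0 normr0.
    have [tx|tx] := lerP t x; first by rewrite !smooth_step_le//; lra.
    by rewrite !smooth_step_ge//; lra.
have : f x - eta / 2 - (f y + eta / 2) <= \int[nu]_(t in `[x, y]) `|g t|.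
  by apply: le_trans low _; rewrite wdE; exact: up.
lra.
Qed.

(** The other sign is the decrement of -f, which has weak derivative -g. *)
Lemma weak_derivative_increment f g x y : 0 < x -> x < y -> y < 1 ->
  {within `[0, 1], continuous f} ->
  nu.-integrable setT (EFin \o f) -> nu.-integrable setT (EFin \o g) ->
  weak_derivative f g -> `|f x - f y| <= \int[nu]_(t in `[x, y]) `|g t|.
Proof.
move=> x0 xy y1 cf intf intg wd; rewrite ler_norml; apply/andP; split; last first.
  exact: weak_derivative_decrement.
rewrite lerNl opprB.
have := @weak_derivative_decrement (\- f) (\- g) x y x0 xy y1.
rewrite opprK addrC; under [leRHS]eq_Rintegral do rewrite normrN.
apply.
- by move=> t; apply: cvgN; exact: cf.
- rewrite (_ : EFin \o _ = -%E \o (EFin \o f))//; exact: integrableN.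
- rewrite (_ : EFin \o _ = -%E \o (EFin \o g))//; exact: integrableN.
(* The signs of -f and -g are carried over to the test function. *)
- move=> phi [dphi cphi sphi].
  have d1N : derive1 (\- phi) = \- derive1 phi by apply/funext => t; rewrite derive1N.
  have tN : test_function (\- phi).
    split.
    - by move=> t; apply: derivableN.
    - by rewrite d1N => t; apply: cvgN; exact: cphi.
    - apply: subset_trans sphi; apply: closure_subset => t /=.
      by rewrite oppr_eq0.
  have := wd _ tN; rewrite d1N.
  by under eq_Rintegral do rewrite mulrN -mulNr;
    under [in X in _ = X -> _]eq_Rintegral do rewrite mulrN -mulNr.
Qed.

End weak_derivative_increment.

(** * Local integrals of the weak derivative *)

Section increments_over_bins.
Context {R : realType}.
Local Notation nu := (@leb01 R).
Implicit Types (f g h : R -> R) (r s t : R).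

Lemma measurable_powR_norm h r : measurable_fun setT h ->
  measurable_fun setT (fun x => (`|h x| `^ r)%:E).
Proof.
move=> mh; apply/measurable_EFinP.
apply: (@measurableT_comp _ _ _ _ _ _ (@powR R ^~ r)) => //.
exact: measurableT_comp.
Qed.

(* Integrated over a bin and optimized in lam, this gives Hoelder's inequality
   up to the constant 2. *)
Lemma norm_le_powR (a lam r : R) : 0 < lam -> 1 <= r ->
  `|a| <= lam + lam `^ (1 - r) * `|a| `^ r.
Proof.
move=> lam0 r1; have [al|la] := lerP `|a| lam.
  by apply: (le_trans al); rewrite lerDl mulr_ge0// powR_ge0.
have a0 : 0 < `|a| by exact: lt_trans la.
apply: (@le_trans _ _ (lam `^ (1 - r) * `|a| `^ r)); last by rewrite lerDr ltW.
have -> : `|a| `^ r = `|a| * `|a| `^ (r - 1).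
  by rewrite mulr_powRB1// (lt_le_trans ltr01).
rewrite mulrCA ler_peMr// -opprB powRN ler_pdivlMl ?powR_gt0// mulr1.
by rewrite ge0_ler_powR ?subr_ge0// ?nnegrE ltW.
Qed.

Lemma bin_integral_powR h r m (j : nat) : (j < m)%N -> 1 <= r ->
  measurable_fun setT h -> nu.-integrable setT (EFin \o h) ->
  (\int[nu]_(x in bin m j) (`|h x| `^ r)%:E < +oo)%E ->
  m%:R `^ (r - 1) * fine (\int[nu]_(x in bin m j) `|h x|%:E)%E `^ r <=
  2 `^ r * fine (\int[nu]_(x in bin m j) (`|h x| `^ r)%:E)%E.
Proof.
move=> jm r1 mh inth Ioo; have m0 : (0 < m)%N by exact: leq_trans jm.
have mR : (0 < m%:R :> R) by rewrite ltr0n.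
have r0 : 0 < r by rewrite (lt_le_trans ltr01).
set G := fine _; set I := fine _.
have G0 : 0 <= G by rewrite fine_ge0// integral_ge0.
have I0 : 0 <= I by rewrite fine_ge0// integral_ge0// => *; rewrite lee_fin powR_ge0.
have mr := measurable_powR_norm r mh.
have mn : measurable_fun setT (fun x => `|h x|%:E).
  by apply/measurable_EFinP; exact: measurableT_comp.
have key lam : 0 < lam -> G <= lam / m%:R + lam `^ (1 - r) * I.
  move=> lam0.
  have mB := @measurable_bin R m j.
  have H : (\int[nu]_(x in bin m j) `|h x|%:E <=
      \int[nu]_(x in bin m j) (lam%:E + (lam `^ (1 - r))%:E * (`|h x| `^ r)%:E))%E.
    apply: ge0_le_integral => //.
    - exact: measurable_funS mn.
    - apply: emeasurable_funD => //; apply: measurable_funeM.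
      exact: measurable_funS mr.
    - by move=> x _; rewrite -EFinM -EFinD lee_fin norm_le_powR.
  move: H; rewrite ge0_integralD//; last 3 first.
  - by move=> x _; rewrite lee_fin ltW.
  - by move=> x _; rewrite -EFinM lee_fin mulr_ge0// powR_ge0.
  - by apply: measurable_funeM; exact: measurable_funS mr.
  rewrite integral_cst// ge0_integralZl//; last 2 first.
  - exact: measurable_funS mr.
  - by rewrite lee_fin powR_ge0.
  rewrite leb01_bin// -[X in (_ <= _ + _ * X)%E]fineK; last first.
    by rewrite ge0_fin_numE// integral_ge0// => *; rewrite lee_fin powR_ge0.
  rewrite -EFinM -EFinM -EFinD => H.
  rewrite -lee_fin /G fineK//.
  rewrite ge0_fin_numE ?integral_ge0//; exact: le_lt_trans H (ltry _).
have [->|Gn0] := eqVneq G 0; first by rewrite powR0 ?gt_eqF// mulr0 mulr_ge0// powR_ge0.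
have Gp : 0 < G by rewrite lt_neqAle eq_sym Gn0.
have [a a0 Ga] : exists2 a, 0 < a & G = 2 * a.
  by exists (G / 2); [rewrite divr_gt0|field].
(* With lam = m G / 2 the term lam / m is half of G and is absorbed on the left. *)
have := key (a * m%:R); rewrite mulr_gt0// => /(_ isT).
rewrite mulfK ?gt_eqF// -lerBlDl Ga.
have -> : 2 * a - a = a by ring.
rewrite -opprB powRN ler_pdivlMl ?powR_gt0 ?mulr_gt0// => H.
rewrite powRM ?(ltW a0)// mulrCA ler_wpM2l ?powR_ge0//.
rewrite -(mulr_powRB1 (ltW a0) r0); apply: le_trans H.
by rewrite powRM ?(ltW a0) ?(ltW mR)// le_eqVlt; apply/orP; left; apply/eqP; ring.
Qed.

Lemma sum_bin_integral_powR h r m : (0 < m)%N -> 1 <= r ->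
  measurable_fun setT h -> nu.-integrable setT (EFin \o h) ->
  (\int[nu]_x (`|h x| `^ r)%:E <= 1)%E ->
  m%:R `^ (r - 1) * \sum_(j < m) fine (\int[nu]_(x in bin m j) `|h x|%:E)%E `^ r
  <= 2 `^ r.
Proof.
move=> m0 r1 mh inth I1; rewrite mulr_sumr.
have mr := measurable_powR_norm r mh.
have r_ge0 x : (0 <= (`|h x| `^ r)%:E)%E by rewrite lee_fin powR_ge0.
move: I1; rewrite (ge0_integral_leb01_sum m0)// => I1.
have Ij (j : 'I_m) : (\int[nu]_(x in bin m j) (`|h x| `^ r)%:E <= 1)%E.
  apply: le_trans I1; rewrite (bigD1 j)//= leeDl// sume_ge0// => i _.
  exact: integral_ge0.
have fj (j : 'I_m) : (\int[nu]_(x in bin m j) (`|h x| `^ r)%:E)%E \is a fin_num.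
  by rewrite ge0_fin_numE ?integral_ge0// (le_lt_trans (Ij j))// ltry.
apply: (@le_trans _ _ (\sum_(j < m)
    2 `^ r * fine (\int[nu]_(x in bin m j) (`|h x| `^ r)%:E)%E)).
  apply: ler_sum => j _; apply: bin_integral_powR => //.
  exact: le_lt_trans (Ij j) (ltry _).
rewrite -mulr_sumr ler_piMr ?powR_ge0// -lee_fin -sumEFin.
by under eq_bigr do rewrite fineK//.
Qed.

(** Up to the null set of bin endpoints, a point of [s, t] lies in a bin with index between j and
    k. *)
Lemma le_integral_over_bins g m (j k : 'I_m) s t :
  measurable_fun setT g -> nu.-integrable setT (EFin \o g) ->
  bin m j s -> bin m k t -> s <= t ->
  \int[nu]_(x in `[s, t]) `|g x| <=
  \sum_(l < m | (j <= l <= k)%N) fine (\int[nu]_(x in bin m l) `|g x|%:E)%E.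
Proof.
move=> mg intg js kt st.
have m0 : (0 < m)%N by exact: leq_trans (ltn_ord j).
have mn : measurable_fun setT (fun x => `|g x|%:E).
  by apply/measurable_EFinP; exact: measurableT_comp.
have [/= _ igfin] := integrableP _ _ _ (integrable_norm intg).
have fD (D : set R) : measurable D -> (\int[nu]_(x in D) `|g x|%:E)%E \is a fin_num.
  move=> mD; rewrite ge0_fin_numE ?integral_ge0//.
  apply: le_lt_trans igfin; under [leRHS]eq_integral do rewrite normr_id.
  exact: ge0_subset_integral.
pose S := [set l : 'I_m | (j <= l <= k)%N]%SET.
rewrite -lee_fin /Rintegral fineK; last exact: fD.
rewrite -sumEFin; under eq_bigr => l _ do rewrite (fineK (fD _ (measurable_bin m l))).
rewrite [leRHS](eq_bigl (fun l : 'I_m => l \in S)); last by move=> l; rewrite /S inE.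
rewrite -ge0_integral_bins//.
rewrite (@ge0_negligible_integral _ _ _ nu _ (~` bins [set: 'I_m]))//; first last.
- exact: leb01_setC_bins.
- exact: measurable_funS mn.
- by apply: measurableC; exact: measurable_bins.
apply: ge0_subset_integral => //.
- by apply: measurableD => //; apply: measurableC; exact: measurable_bins.
- exact: measurable_bins.
- exact: measurable_funS mn.
move=> u [/=]; rewrite in_itv/= => /andP[su ut] /contrapT/binsP[l _ lu].
apply/binsP; exists l => //; rewrite inE.
move: js kt lu => /(binP _ _ m0)/andP[a1 a2] /(binP _ _ m0)/andP[b1 b2].
move=> /(binP _ _ m0)/andP[c1 c2].
have mR : (0 < m%:R :> R) by rewrite ltr0n.
have := ler_wpM2l (ltW mR) su; have := ler_wpM2l (ltW mR) ut => e1 e2.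
have : j%:R < l.+1%:R :> R by lra.
have : l%:R < k.+1%:R :> R by lra.
by rewrite !ltr_nat !ltnS => -> ->.
Qed.

Lemma sobolev_increments f g m (j k : 'I_m) s t :
  measurable_fun setT g -> {within `[0, 1], continuous f} ->
  nu.-integrable setT (EFin \o f) -> nu.-integrable setT (EFin \o g) ->
  weak_derivative f g -> bin m j s -> bin m k t ->
  `|f s - f t| <= \sum_(l < m | (minn j k <= l <= maxn j k)%N)
    fine (\int[nu]_(x in bin m l) `|g x|%:E)%E.
Proof.
move=> mg cf intf intg wd js kt.
wlog st : j k s t js kt / s <= t.
  move=> H; have [st|/ltW ts] := lerP s t; first exact: H.
  by rewrite distrC minnC maxnC; exact: H.
have m0 : (0 < m)%N by exact: leq_trans (ltn_ord j).
have jk : (j <= k)%N.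
  move: js kt => /(binP _ _ m0)/andP[a1 a2] /(binP _ _ m0)/andP[b1 b2].
  have mR : (0 < m%:R :> R) by rewrite ltr0n.
  have := ler_wpM2l (ltW mR) st => e1.
  have : j%:R < k.+1%:R :> R by lra.
  by rewrite ltr_nat.
rewrite (minn_idPl jk) (maxn_idPr jk).
have [->|nst] := eqVneq s t.
  rewrite subrr normr0 sumr_ge0// => l _.
  by rewrite fine_ge0// integral_ge0.
apply: (le_trans _ (le_integral_over_bins mg intg js kt st)).
apply: weak_derivative_increment => //.
- by have /andP[] := bin01 (ltn_ord j) js.
- by rewrite lt_neqAle nst.
- by have /andP[] := bin01 (ltn_ord k) kt.
Qed.

End increments_over_bins.

(** * What membership in the Sobolev ball provides *)

Section sobolev_ball_bounds.
Context {R : realType}.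
Local Notation nu := (@leb01 R).
Implicit Types (f g h : R -> R) (r s t : R) (p : \bar R).

Lemma poweR_invr_le1 (x : \bar R) r : 0 < r -> (0 <= x)%E ->
  (x `^ r^-1 <= 1)%E -> (x <= 1)%E.
Proof.
move=> r0 x0 x1; have -> : x = ((x `^ r^-1) `^ r)%E.
  by rewrite -poweRrM mulVf ?gt_eqF// poweRe1.
rewrite -(@poweR1r _ r); apply: gt0_ler_poweR => //; first exact: ltW.
- by rewrite in_itv/= poweR_ge0 leey.
- by rewrite in_itv/= lee01 leey.
Qed.

Lemma Lp_norm_powR h r : 0 < r ->
  (Lp_norm r%:E h `^ r = \int[nu]_x (`|h x| `^ r)%:E)%E.
Proof.
by move=> r0; rewrite /Lp_norm poweR_Lnorm ?gt_eqF.
Qed.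

Lemma ae_leb01_impl (P Q : R -> Prop) : (forall x, P x -> Q x) ->
  (\forall x \ae nu, P x) -> (\forall x \ae nu, Q x).
Proof.
move=> PQ h; have F := ae_filter_ringOfSetsType nu.
by apply: filterS h.
Qed.

Lemma ae_leb01_le1 h r : 1 <= r -> measurable_fun setT h ->
  (\forall x \ae nu, `|h x|%:E <= 1%E)%E ->
  (\int[nu]_x (`|h x| `^ r)%:E <= 1)%E.
Proof.
move=> r1 mh h1; rewrite -[leRHS](@leb01T R) -[leRHS]mul1e -integral_cst//.
apply: ae_ge0_le_integral => //.
- exact: measurable_powR_norm.
- apply: ae_leb01_impl h1 => x; rewrite !lee_fin => hx _.
  have -> : 1 = 1 `^ r :> R by rewrite powR1.
  by rewrite ge0_ler_powR ?nnegrE// (le_trans ler01).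
Qed.

Lemma Lp_normy_ae h : (Lp_norm +oo h <= 1)%E -> (\forall x \ae nu, `|h x|%:E <= 1)%E.
Proof.
by rewrite /Lp_norm unlock leb01T lte01 => /ess_supP.
Qed.

(** For p = +oo the exponent r is free: on a space of mass 1 an essential bound by 1 bounds every
    r-th integral by 1. Finite and infinite p thus share one argument, and for q < p = +oo a finite
    r above q stands in for p. The essential bound on |g| is kept for p = q = +oo. *)
Lemma sobolev_ball_bounds p r f : 1 <= r -> p = r%:E \/ p = +oo%E ->
  sobolev_ball p f -> exists g, [/\
    [/\ measurable_fun setT f, measurable_fun setT g,
        nu.-integrable setT (EFin \o f) & nu.-integrable setT (EFin \o g)],
    {within `[0, 1], continuous f}, weak_derivative f g,
    (\int[nu]_x (`|f x| `^ r)%:E <= 1)%E /\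
      (\int[nu]_x (`|g x| `^ r)%:E <= 1)%E
    & p = +oo%E -> (\forall x \ae nu, `|g x|%:E <= 1)%E].
Proof.
move=> r1 pr [g [Lf cf Lg wd] N1]; exists g.
have r0 : 0 < r by exact: lt_le_trans r1.
have p1 : (1 <= p)%E by case: pr => ->; rewrite ?leey// lee_fin.
have sub : {subset Lfun nu p <= Lfun nu 1%E}.
  by apply: Lfun_subset => //; rewrite leb01T.
have mf : measurable_fun setT f.
  by move: Lf; rewrite inE => /andP[/[!inE]].
have mg : measurable_fun setT g.
  by move: Lg; rewrite inE => /andP[/[!inE]].
have intf : nu.-integrable setT (EFin \o f) by apply/Lfun1_integrable/sub.
have intg : nu.-integrable setT (EFin \o g) by apply/Lfun1_integrable/sub.
case: pr => pE; subst p.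
  move: N1; rewrite /sobolev_norm !Lp_norm_powR// => N1.
  have If : (0 <= \int[nu]_x (`|f x| `^ r)%:E)%E.
    by apply: integral_ge0 => x _; rewrite lee_fin powR_ge0.
  have Ig : (0 <= \int[nu]_x (`|g x| `^ r)%:E)%E.
    by apply: integral_ge0 => x _; rewrite lee_fin powR_ge0.
  have {}N1 := poweR_invr_le1 r0 (adde_ge0 If Ig) N1.
  split; [by split|exact: cf|exact: wd|split|by []].
  - exact: le_trans (leeDl _ Ig) N1.
  - exact: le_trans (leeDr _ If) N1.
move: N1; rewrite /sobolev_norm ge_max => /andP[/Lp_normy_ae f1 /Lp_normy_ae g1].
by split => //; split; exact: ae_leb01_le1.
Qed.

(** [G l] is the integral of |g| over bin l. Only these numbers enter the upper bounds for the
    radius; g does not appear there again. *)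
Lemma sobolev_ball_increments p r f m : 1 <= r -> p = r%:E \/ p = +oo%E ->
  sobolev_ball p f -> (0 < m)%N -> exists G : 'I_m -> R, [/\
    forall l, 0 <= G l,
    m%:R `^ (r - 1) * \sum_(l < m) G l `^ r <= 2 `^ r,
    forall (j k : 'I_m) s t, bin m j s -> bin m k t ->
      `|f s - f t| <= \sum_(l < m | (minn j k <= l <= maxn j k)%N) G l
    & p = +oo%E -> forall l, G l <= m%:R^-1].
Proof.
move=> r1 pr Bf m0.
have [g [[mf mg intf intg] cf wd [If Ig] gy]] := sobolev_ball_bounds r1 pr Bf.
exists (fun l => fine (\int[nu]_(x in bin m l) `|g x|%:E)%E); split.
- by move=> l; rewrite fine_ge0// integral_ge0.
- exact: sum_bin_integral_powR.
- move=> j k s t js kt; exact: sobolev_increments.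
- move=> /gy g1 l; rewrite -lee_fin.
  have mn : measurable_fun setT (fun x => `|g x|%:E).
    by apply/measurable_EFinP; exact: measurableT_comp.
  have H : (\int[nu]_(x in bin m l) `|g x|%:E <= (m%:R^-1)%:E)%E.
    rewrite -(leb01_bin (ltn_ord l)) -[leRHS]mul1e -integral_cst; last exact: measurable_bin.
    apply: ae_ge0_le_integral => //.
    + exact: measurable_bin.
    + exact: measurable_funS mn.
    + by apply: ae_leb01_impl g1.
  rewrite fineK// ge0_fin_numE ?integral_ge0//.
  exact: le_lt_trans H (ltry _).
Qed.

(** If |f| exceeded 2 on all of ]0, 1[, its r-th integral would exceed 1. So |f s| <= 2 for some s,
    and the increment bound with a single bin adds at most [G ord0] <= 2. *)
Lemma sobolev_ball_le4 p f t : (1 <= p)%E -> sobolev_ball p f -> 0 < t < 1 ->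
  `|f t| <= 4.
Proof.
move=> p1 Bf t01.
have [r r1 pr] : exists2 r : R, 1 <= r & p = r%:E \/ p = +oo%E.
  by case: p p1 Bf => [r r1 _| _ _|//]; [exists r => //; left|exists 1 => //; right].
have r0 : 0 < r by exact: lt_le_trans r1.
have [g [[mf _ _ _] _ _ [If _] _]] := sobolev_ball_bounds r1 pr Bf.
have [s s01 fs] : exists2 s : R, 0 < s < 1 & `|f s| <= 2.
  apply/not_exists2P => H.
  suff : (1 < \int[nu]_x (`|f x| `^ r)%:E)%E by rewrite ltNge If.
  apply: (@lt_le_trans _ _ (\int[nu]_(x in `]0%R, 1%R[) (2 `^ r)%:E)%E).
    rewrite integral_cst// leb01_itv// subr0 mule1 lte_fin.
    by rewrite (@lt_le_trans _ _ 2)// ?ltr1n// le1r_powR// ler1n.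
  apply: (@le_trans _ _ (\int[nu]_(x in `]0%R, 1%R[) (`|f x| `^ r)%:E)%E).
    apply: ge0_le_integral => //.
    - by apply: measurable_funTS; exact: measurable_powR_norm.
    - move=> x /=; rewrite in_itv/= => x01.
      have [//|/negP] := H x; rewrite -ltNge => h.
      by rewrite lee_fin ge0_ler_powR ?nnegrE// ltW.
  by apply: ge0_subset_integral => //; exact: measurable_powR_norm.
have [G [G0 GS inc _]] := sobolev_ball_increments r1 pr Bf (ltn0Sn 0).
have bin1 (x : R) : 0 < x < 1 -> bin 1 (@ord0 0) x.
  by move=> x01; apply/binP => //; rewrite mul1r.
have := inc ord0 ord0 s t (bin1 _ s01) (bin1 _ t01).
rewrite big_mkcond big_ord1/= => st.
have G2 : G ord0 <= 2.
  move: GS; rewrite powR1 /= mul1r big_ord1 => GS.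
  rewrite leNgt; apply/negP => G2; move: GS; apply/negP; rewrite -ltNge.
  by rewrite gt0_ltr_powR// nnegrE ltW// (lt_trans _ G2).
have := ler_normB (f s) (f s - f t).
have -> : f s - (f s - f t) = f t by ring.
by move=> h; apply: (le_trans h); have := le_trans st G2; lra.
Qed.

End sobolev_ball_bounds.

(** * Upper bounds for the radius *)

Section upper_bounds.
Context {R : realType}.
Local Notation nu := (@leb01 R).
Implicit Types (f g h : R -> R) (r s t : R) (p q : \bar R).

Lemma Lp_norm_bins_le h m (E : 'I_m -> R) s : (0 < m)%N -> 0 < s ->
  measurable_fun setT h -> (forall (j : 'I_m) t, bin m j t -> `|h t| <= E j) ->
  (forall j, 0 <= E j) ->
  (Lp_norm s%:E h <= ((m%:R^-1 * \sum_(j < m) E j `^ s) `^ s^-1)%:E)%E.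
Proof.
move=> m0 s0 mh hE E0; have mr := measurable_powR_norm s mh.
have -> : Lp_norm s%:E h = ((\int[nu]_x (`|h x| `^ s)%:E) `^ s^-1)%E.
  by rewrite /Lp_norm unlock.
rewrite -poweR_EFin; apply: gt0_ler_poweR.
- by rewrite invr_ge0 ltW.
- by rewrite in_itv/= leey andbT integral_ge0// => x _; rewrite lee_fin powR_ge0.
- rewrite in_itv/= leey andbT lee_fin mulr_ge0// sumr_ge0// => j _.
  exact: powR_ge0.
rewrite (ge0_integral_leb01_sum m0)//.
rewrite mulr_sumr -sumEFin; apply: lee_sum => j _.
rewrite mulrC EFinM -(leb01_bin (ltn_ord j)) -integral_cst; last exact: measurable_bin.
apply: ge0_le_integral => //.
- exact: measurable_bin.
- exact: measurable_funS mr.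
- move=> x jx; rewrite lee_fin ge0_ler_powR ?nnegrE//; first exact: ltW.
  exact: hE.
Qed.

Lemma Lp_normy_bins_le h m c : (0 < m)%N ->
  (forall j t, (j < m)%N -> bin m j t -> `|h t| <= c) -> (Lp_norm +oo h <= c%:E)%E.
Proof.
move=> m0 hc; rewrite /Lp_norm unlock leb01T lte01; apply/ess_supP.
exists (~` bins [set: 'I_m]); split.
- by apply: measurableC; exact: measurable_bins.
- exact: leb01_setC_bins.
move=> x /=; apply: contra_not => /binsP[j _ jx].
by rewrite lee_fin; exact: (hc j).
Qed.

Definition step_fun m (v : 'I_m -> R) (t : R) : R := \sum_(j < m) v j * \1_(bin m j) t.

Lemma step_fun_bin m (v : 'I_m -> R) (j : 'I_m) t :
  bin m j t -> step_fun v t = v j.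
Proof.
move=> jt; have m0 : (0 < m)%N by exact: leq_trans (ltn_ord j).
rewrite /step_fun (bigD1 j)//= indicE mem_set// mulr1 big1 ?addr0// => i ij.
rewrite indicE memNset ?mulr0// => it; move/eqP: ij; apply.
by apply/val_inj; exact: (bin_inj m0 it jt).
Qed.

Lemma measurable_step_fun m (v : 'I_m -> R) : measurable_fun setT (step_fun v).
Proof.
apply: measurable_sum => j; apply: measurable_funM => //.
by apply: measurable_indic; exact: measurable_bin.
Qed.

Lemma step_fun_Lfun m (v : 'I_m -> R) q : (0 < m)%N -> (1 <= q)%E ->
  step_fun v \in Lfun nu q.
Proof.
move=> m0 q1; rewrite inE; apply/andP; split; rewrite inE/=.
  exact: measurable_step_fun.
rewrite /finite_norm; case: q q1 => [s| _|//].
  rewrite lee_fin => s1; apply: le_lt_trans (ltry _).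
  apply: (@Lp_norm_bins_le _ _ (fun j => `|v j|)) => //.
  - exact: lt_le_trans s1.
  - exact: measurable_step_fun.
  - by move=> j t jt; rewrite (step_fun_bin _ jt).
apply: le_lt_trans (ltry _).
apply: (@Lp_normy_bins_le _ m (\sum_(j < m) `|v j|)) => // j t jm jt.
rewrite (@step_fun_bin _ v (Ordinal jm) t jt) (bigD1 (Ordinal jm))//= lerDl.
by rewrite sumr_ge0.
Qed.

Lemma sobolev_ball_measurable p f : sobolev_ball p f -> measurable_fun setT f.
Proof. by case=> g [Lf _ _ _] _; move: Lf; rewrite inE => /andP[/[!inE]]. Qed.

(** The mapping phi is chosen after the points, so [sigma] may depend on them; [sigma j] is the
    index of the sample used on bin j. *)
Lemma radius_le_step p q n m (x : 'I_n -> R) (sigma : 'I_m -> 'I_n) (B : \bar R) :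
  (0 < m)%N -> (1 <= q)%E ->
  (forall f, sobolev_ball p f ->
    Lp_norm q (f \- step_fun (fun j => f (x (sigma j))))%R <= B)%E ->
  (radius_of_information p q x <= B)%E.
Proof.
move=> m0 q1 H; apply: ge_ereal_inf.
exists (ereal_sup [set Lp_norm q (f \- step_fun (fun j => f (x (sigma j))))
                   | f in sobolev_ball p]); last first.
  by apply: ge_ereal_sup => _ [f Bf <-]; exact: H.
exists (fun y : 'rV[R]_n => step_fun (fun j => y ord0 (sigma j))).
  by move=> y /=; exact: step_fun_Lfun.
congr ereal_sup; apply: eq_imagel => f Bf /=; congr (Lp_norm q _).
by apply/funext => t /=; congr (_ - step_fun _ t); apply/funext => j; rewrite mxE.
Qed.

Lemma Lp_norm_le_bound h c q : (1 <= q)%E -> measurable_fun setT h ->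
  (forall t, 0 < t < 1 -> `|h t| <= c) -> (Lp_norm q h <= c%:E)%E.
Proof.
move=> q1 mh hc; have c0 : 0 <= c by apply: le_trans (hc 2^-1 _) => //; lra.
case: q q1 => [s| _|//]; last first.
  apply: (@Lp_normy_bins_le _ 1) => // j t j1 jt.
  by apply: hc; exact: bin01 jt.
rewrite lee_fin => s1; have s0 : 0 < s by exact: lt_le_trans s1.
apply: le_trans (@Lp_norm_bins_le h 1 (fun=> c) s _ _ _ _ _) _ => //.
  by move=> j t jt; apply: hc; exact: bin01 jt.
rewrite big_ord1 invr1 mul1r -powRrM mulfV ?gt_eqF// powRr1//.
Qed.

(** Achieved by the zero mapping, written as a step function on one bin. It pays for the events on
    which the samples are badly placed. *)
Lemma radius_le4 p q n (x : 'I_n -> R) : (1 <= p)%E -> (1 <= q)%E ->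
  (radius_of_information p q x <= 4%:E)%E.
Proof.
move=> p1 q1; apply: ge_ereal_inf.
exists (ereal_sup [set Lp_norm q (f \- step_fun (fun=> 0 : R) (m := 1))
                   | f in sobolev_ball p]); last first.
  apply: ge_ereal_sup => _ [f Bf <-]; apply: Lp_norm_le_bound => //.
    apply: measurable_funB; first exact: sobolev_ball_measurable Bf.
    exact: measurable_step_fun.
  move=> t t01 /=; rewrite /step_fun big_ord1 mul0r subr0.
  exact: sobolev_ball_le4 Bf t01.
exists (fun=> @step_fun 1 (fun=> 0)) => //= y.
exact: step_fun_Lfun.
Qed.

End upper_bounds.

(** * Inequalities for sums of real powers *)

Section power_sums.
Context {R : realType}.
Implicit Types (a b c r s t : R).

Lemma powR_lower (c r x : R) : 0 < r -> 0 <= c -> 0 <= x -> x `^ r <= c `^ r -> x <= c.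
Proof.
move=> r0 c0 x0; rewrite !leNgt; apply: contra => cx.
by rewrite gt0_ltr_powR ?nnegrE.
Qed.

(** The embedding of l_r into l_s: every [G i] is at most c, so its s-th power is at most c^(s - r)
    times its r-th power. *)
Lemma sum_powR_mono (I : finType) (G : I -> R) c r s : 0 < r -> r <= s -> 0 <= c ->
  (forall i, 0 <= G i) -> \sum_i G i `^ r <= c `^ r -> \sum_i G i `^ s <= c `^ s.
Proof.
move=> r0 rs c0 G0 H.
have [->|rsN] := eqVneq s r; first by [].
have rs' : r < s by rewrite lt_neqAle eq_sym rsN.
have s0 : 0 < s by exact: lt_trans rs'.
have Gc i : G i <= c.
  apply: (powR_lower r0) => //; apply: le_trans H.
  by rewrite (bigD1 i)//= lerDl sumr_ge0// => k _; exact: powR_ge0.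
have E x : 0 <= x -> x `^ s = x `^ (s - r) * x `^ r.
  move=> x0; rewrite -powRD ?subrK//.
  by apply/implyP => /eqP s00; move: s0; rewrite s00 ltxx.
rewrite (E c)//; apply: (@le_trans _ _ (c `^ (s - r) * \sum_i G i `^ r)).
  rewrite mulr_sumr; apply: ler_sum => i _.
  rewrite (E (G i))// ler_wpM2r ?powR_ge0// ge0_ler_powR ?nnegrE//.
  by rewrite subr_ge0.
by rewrite ler_wpM2l ?powR_ge0.
Qed.

Lemma powR_scale (m : nat) r (x : R) : (0 < m)%N -> 1 <= r ->
  m%:R `^ (r - 1) * x <= 2 `^ r -> x <= (2 * m%:R `^ (-1 + r^-1)) `^ r.
Proof.
move=> m0 r1 H; have r0 : 0 < r by exact: lt_le_trans r1.
rewrite powRM ?powR_ge0// -powRrM mulrDl mulVf ?gt_eqF// mulN1r addrC.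
by rewrite -opprB powRN mulrC ler_pdivlMl// powR_gt0// ltr0n.
Qed.

(** The absolute difference: one of the two truncated subtractions is 0. *)
Definition dist (j k : nat) : nat := (j - k + (k - j))%N.

Lemma sum_inv_sqr_dist (l m : nat) :
  \sum_(j < m) ((dist l j).+1%:R ^+ 2)^-1 <= 4 :> R.
Proof.
(* Majorant of the partial sums, from telescoping 1/(k+1)^2 <= 1/k - 1/(k+1): it is 1 / (l - m + 1)
   up to the centre l and 4 - 1 / (m - l) beyond it. *)
pose u m : R := if (m <= l)%N then ((l - m).+1%:R)^-1 else 4 - (m - l)%:R^-1.
suff H : \sum_(j < m) ((dist l j).+1%:R ^+ 2)^-1 <= u m.
  apply: (le_trans H); rewrite /u; case: ifPn => _.
    by apply: (@le_trans _ _ 1); [rewrite invf_le1 ?ltr0n// ler1n|lra].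
  by rewrite gerBl invr_ge0.
elim: m => [|m IH]; first by rewrite big_ord0 /u/= invr_ge0.
rewrite big_ord_recr/=; apply: le_trans (lerD IH (lexx _)) _.
rewrite /u /dist; have [lm|ml|lm] := ltngtP m l.
- have -> : (m - l)%N = 0%N by apply/eqP; rewrite subn_eq0 ltnW.
  rewrite addn0; have [k ->] : exists k, l = (m + k.+1)%N.
    by exists (l - m).-1; rewrite prednK ?subn_gt0// subnKC// ltnW.
  rewrite addKn (_ : (m + k.+1 - m.+1 = k)%N); last by lia.
  rewrite -(natr1 k.+1); set x : R := k.+1%:R.
  have x0 : 0 < x by rewrite ltr0n.
  rewrite -subr_ge0 (_ : _ - _ = (x * (x + 1) ^+ 2)^-1); last first.
    by field; rewrite !gt_eqF//; lra.
  by rewrite invr_ge0 mulr_ge0 ?exprn_ge0//; lra.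
- have -> : (l - m)%N = 0%N by apply/eqP; rewrite subn_eq0 ltnW.
  rewrite add0n.
  have [k ->] : exists k, m = (l + k.+1)%N.
    by exists (m - l).-1; rewrite prednK ?subn_gt0// subnKC// ltnW.
  rewrite (_ : ((l + k.+1).+1 - l = k.+2)%N) ?addKn; last by lia.
  rewrite -(natr1 k.+1); set x : R := k.+1%:R.
  have x0 : 0 < x by rewrite ltr0n.
  rewrite -subr_ge0 (_ : _ - _ = (x * (x + 1) ^+ 2)^-1); last first.
    by field; rewrite !gt_eqF//; lra.
  by rewrite invr_ge0 mulr_ge0 ?exprn_ge0//; lra.
- rewrite lm subnn subSnn/= expr1n invr1; lra.
Qed.

Lemma card_near m (j : 'I_m) K : (#|[pred l : 'I_m | dist l j <= K]| <= K.*2.+1)%N.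
Proof.
rewrite cardE -(size_map val) -(size_iota (j - K) K.*2.+1).
apply: uniq_leq_size; first by rewrite map_inj_uniq ?enum_uniq//; exact: val_inj.
move=> _ /mapP[l + ->]; rewrite mem_enum inE mem_iota /dist.
by move=> /= H; lia.
Qed.

(** The sum is at most N times its largest term, whose s-th power occurs on the right. This is
    cruder than convexity by a factor N, which is harmless where only some power of N is wanted. *)
Lemma powR_sum_le (I : finType) (P : pred I) (G : I -> R) (N : nat) s :
  0 < s -> (forall i, 0 <= G i) -> (#|P| <= N)%N ->
  (\sum_(i | P i) G i) `^ s <= N%:R `^ s * \sum_(i | P i) G i `^ s.
Proof.
move=> s0 G0 PN.
have [i0 Pi0|P0] := pickP P; last first.
  by rewrite !big_pred0// powR0 ?gt_eqF// mulr0.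
have [i Pi Hi] := arg_maxP G Pi0.
apply: (@le_trans _ _ ((N%:R * G i) `^ s)).
  rewrite ge0_ler_powR ?nnegrE ?mulr_ge0 ?sumr_ge0//; first exact: ltW.
  apply: (@le_trans _ _ (\sum_(k | P k) G i)); first exact: ler_sum.
  by rewrite sumr_const -[leLHS]mulr_natl ler_wpM2r// ler_nat.
rewrite powRM// ler_wpM2l ?powR_ge0// (bigD1 i)//= lerDl.
by rewrite sumr_ge0// => k _; exact: powR_ge0.
Qed.

(* Replaces Hoelder's inequality with exponents 1/th and 1/(1-th): either the
   first term on the right dominates, or c is bounded by a power of N. The factor
   D ^- 2 makes the first term summable over the bins at distance D - 1. *)
Lemma powR_tradeoff (c N D : R) th s : 0 <= c -> 1 <= N -> 0 < D -> D <= N ->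
  0 < th < 1 -> 0 < s ->
  c `^ th * N `^ s <= c / D ^+ 2 + N `^ ((s + 2) / (1 - th)).
Proof.
move=> c0 N1 D0 DN /andP[th0 th1] s0.
have N0 : 0 < N by exact: lt_le_trans N1.
have Dc : 0 <= c / D ^+ 2 by rewrite divr_ge0// exprn_ge0// ltW.
have [H|H] := lerP (c `^ th * N `^ s) (c / D ^+ 2).
  by apply: (le_trans H); rewrite lerDl powR_ge0.
have t1 : 0 < 1 - th by rewrite subr_gt0.
have cp : 0 < c.
  rewrite lt_neqAle c0 andbT eq_sym; apply/eqP => c00; move: H.
  by rewrite c00 powR0 ?gt_eqF// !mul0r ltxx.
have cE : c = c `^ th * c `^ (1 - th).
  by rewrite -powRD ?(gt_eqF cp) ?implybT// addrC subrK powRr1.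
(* If the first alternative fails, division by c^th leaves c^(1 - th) < N^s D^2 <= N^(s + 2). *)
have cN : c `^ (1 - th) <= N `^ (s + 2).
  have : c < c `^ th * (N `^ s * D ^+ 2).
    by move: H; rewrite ltr_pdivrMr ?exprn_gt0// mulrA.
  rewrite {1}cE ltr_pM2l ?powR_gt0// => /ltW/le_trans; apply.
  rewrite powRD; last by rewrite (gt_eqF N0) implybT.
  rewrite ler_wpM2l ?powR_ge0// powR_mulrn ?(ltW N0)//.
  by rewrite lerXn2r ?nnegrE// ltW.
have cN' : c <= N `^ ((s + 2) / (1 - th)).
  apply: (powR_lower t1) => //; first exact: powR_ge0.
  by rewrite -powRrM mulfVK// gt_eqF.
apply: (@le_trans _ _ (N `^ ((s + 2) / (1 - th)))); last by rewrite lerDr.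
apply: (@le_trans _ _ ((N `^ ((s + 2) / (1 - th))) `^ th * N `^ s)).
  rewrite ler_wpM2r ?powR_ge0// ge0_ler_powR ?nnegrE ?powR_ge0//.
  exact: ltW.
rewrite -powRrM -powRD; last by rewrite (gt_eqF N0) implybT.
rewrite ler_powR//.
have -> : (s + 2) / (1 - th) * th + s = (s + 2) / (1 - th) - 2.
  by field; rewrite gt_eqF.
lra.
Qed.

End power_sums.

Section radius_upper_bounds.
Context {R : realType}.
Local Notation nu := (@leb01 R).
Implicit Types (f g h : R -> R) (r s t : R) (p q : \bar R).

Lemma fine_invE r : r != 0 -> fine (r%:E^-1)%E = r^-1.
Proof. by move=> r0; rewrite inver (negbTE r0). Qed.

(** On a bin that holds a sample the error is at most [G j]. For p <= q the l_q norm of [G] is at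
    most its l_p norm, hence at most 2 m^(-1+1/p), and averaging over the m bins supplies the factor
    m^(-1/q). *)
Lemma radius_occupied p q n m (x : 'I_n -> R) : (0 < m)%N -> (1 <= p)%E ->
  (p <= q)%E -> (forall j : 'I_m, exists i, bin m j (x i)) ->
  (radius_of_information p q x <=
    (2 * m%:R `^ (-1 + fine p^-1%E - fine q^-1%E))%:E)%E.
Proof.
move=> m0 p1 pq /choice[sigma hsigma].
have mR : (0 < m%:R :> R) by rewrite ltr0n.
have q1 : (1 <= q)%E by exact: le_trans pq.
apply: (radius_le_step (sigma := sigma)) => // f Bf.
have [r r1 pr] : exists2 r : R, 1 <= r & p = r%:E \/ p = +oo%E.
  by case: p p1 {pq Bf} => [r r1| _|//]; [exists r => //; left|exists 1 => //; right].
have r0 : 0 < r by exact: lt_le_trans r1.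
have [G [G0 GS inc Gy]] := sobolev_ball_increments r1 pr Bf m0.
pose c : R := 2 * m%:R `^ (-1 + r^-1).
have c0 : 0 <= c by rewrite mulr_ge0// powR_ge0.
have GSc : \sum_(l < m) G l `^ r <= c `^ r by exact: powR_scale GS.
have Gc l : G l <= c.
  apply: (powR_lower r0) => //; apply: le_trans GSc.
  by rewrite (bigD1 l)//= lerDl sumr_ge0// => k _; exact: powR_ge0.
set h := f \- _.
have mh : measurable_fun setT h.
  apply: measurable_funB; first exact: sobolev_ball_measurable Bf.
  exact: measurable_step_fun.
have hG (j : 'I_m) t : bin m j t -> `|h t| <= G j.
  move=> jt; rewrite /h /= (step_fun_bin _ jt).
  apply: (le_trans (inc _ _ _ _ jt (hsigma j))).
  rewrite minnn maxnn (big_pred1 j)// => l.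
  apply/andP/eqP => [[jl lj]|->]; last by rewrite leqnn.
  by apply/val_inj/eqP; rewrite eqn_leq lj jl.
case: q pq q1 => [s|_ _|]; last by rewrite leNgt; case: (p) p1.
- move=> ps s1; case: pr => pE; last by move: ps; rewrite pE.
  rewrite pE !fine_invE ?gt_eqF ?(lt_le_trans ltr01)//.
  have rs : r <= s by rewrite -lee_fin -pE.
  have s0 : 0 < s by exact: lt_le_trans rs.
  apply: (le_trans (Lp_norm_bins_le m0 s0 mh hG G0)); rewrite lee_fin.
  have H := sum_powR_mono r0 rs c0 G0 GSc.
  apply: (@le_trans _ _ ((m%:R^-1 * c `^ s) `^ s^-1)).
    rewrite ge0_ler_powR ?nnegrE ?invr_ge0 ?(ltW s0)//.
    - by rewrite mulr_ge0 ?invr_ge0// sumr_ge0// => k _; exact: powR_ge0.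
    - by rewrite mulr_ge0 ?invr_ge0// powR_ge0.
    - by rewrite ler_wpM2l// invr_ge0.
  rewrite powRM ?invr_ge0 ?powR_ge0// -powRrM mulfV ?gt_eqF// powRr1//.
  rewrite /c mulrCA ler_wpM2l// mulrC -[m%:R^-1]powR_inv1// -powRrM mulN1r.
  by rewrite -powRD// (gt_eqF mR) implybT.
(* For q = +oo the largest [G j] decides: it is at most c for finite p and at most 1 / m for p =
   +oo. *)
- case: pr => pE.
    apply: (@Lp_normy_bins_le _ _ m) => // j t jm jt.
    apply: (le_trans (hG (Ordinal jm) t jt)); apply: (le_trans (Gc _)).
    by rewrite pE invey fine_invE ?gt_eqF//= subr0.
  apply: (@Lp_normy_bins_le _ _ m) => // j t jm jt.
  apply: (le_trans (hG (Ordinal jm) t jt)); apply: (le_trans (Gy pE _)).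
  rewrite pE invey /= addr0 subr0 powR_inv1// ler_peMl// ?ler1n//.
Qed.

(** The exponent that [powR_tradeoff] yields for th = s / r; it blows up as s approaches r. *)
Definition near_exponent r s : R := (s + 2) / (1 - s / r).

(** The error on bin j is at most the sum of [G] over the bins within [K j] of j, among them the
    occupied bin [c j]. The resulting bound is uniform in f and depends on the points through [K]
    alone. *)
Lemma radius_nearest p s n m (x : 'I_n -> R) r (K : 'I_m -> nat) (c : 'I_m -> 'I_m) :
  (0 < m)%N -> 1 <= s -> s < r -> p = r%:E \/ p = +oo%E ->
  (forall j, exists i, bin m (c j) (x i)) -> (forall j : 'I_m, (dist j (c j) <= K j)%N) ->
  (radius_of_information p s%:E x <= (2 / m%:R *
    (4 + m%:R^-1 * \sum_(j < m) (K j).*2.+1%:R `^ (near_exponent r s + 1)))%:E)%E.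
Proof.
move=> m0 s1 sr pr /choice[sigma hsigma] cK.
have mR : (0 < m%:R :> R) by rewrite ltr0n.
have s0 : 0 < s by exact: lt_le_trans s1.
have r0 : 0 < r by exact: lt_trans sr.
have r1 : 1 <= r by exact: le_trans (ltW sr).
apply: (radius_le_step (sigma := sigma)) => // f Bf.
have [G [G0 GS inc _]] := sobolev_ball_increments r1 pr Bf m0.
pose near (j l : 'I_m) := (dist l j <= K j)%N.
pose E j := \sum_(l < m | near j l) G l.
have E0 j : 0 <= E j by rewrite sumr_ge0.
set h := f \- _.
have mh : measurable_fun setT h.
  apply: measurable_funB; first exact: sobolev_ball_measurable Bf.
  exact: measurable_step_fun.
have hE (j : 'I_m) t : bin m j t -> `|h t| <= E j.
  move=> jt; rewrite /h /= (step_fun_bin _ jt).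
  apply: (le_trans (inc _ _ _ _ jt (hsigma j))).
  rewrite big_mkcond [leRHS]big_mkcond/=; apply: ler_sum => l _.
  case: ifPn => [jl|_]; last by case: ifP.
  suff -> : near j l by [].
  by move: jl (cK j); rewrite /near /dist; lia.
apply: (le_trans (Lp_norm_bins_le m0 s0 mh hE E0)); rewrite lee_fin.
pose th := s / r.
have th0 : 0 < th by rewrite divr_gt0.
have th1 : th < 1 by rewrite ltr_pdivrMr// mul1r.
(* Scaled so that the r-th powers of [b] have mean at most 1. *)
pose b l := G l * (m%:R / 2).
have b0 l : 0 <= b l by rewrite mulr_ge0// divr_ge0.
have GE l : G l = 2 / m%:R * b l by rewrite /b; field; rewrite gt_eqF.
have bS : \sum_(l < m) b l `^ r <= m%:R.
  have -> : m%:R = (m%:R / 2) `^ r * (2 * m%:R `^ (-1 + r^-1)) `^ r.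
    rewrite -powRM ?mulr_ge0 ?powR_ge0 ?invr_ge0//.
    rewrite (_ : _ * _ = m%:R * m%:R `^ (-1 + r^-1)); last by field.
    rewrite -[X in _ = (X * _) `^ _]powRr1// -powRD; last by rewrite (gt_eqF mR) implybT.
    by rewrite addrA subrr add0r -powRrM mulVf ?gt_eqF// powRr1.
  apply: le_trans (ler_wpM2l (powR_ge0 _ _) (powR_scale m0 r1 GS)).
  rewrite mulr_sumr; apply: ler_sum => l _.
  by rewrite /b powRM ?divr_ge0// mulrC.
pose N j : R := (K j).*2.+1%:R.
have N1 j : 1 <= N j by rewrite ler1n.
set M := near_exponent r s + 1.
have Ej j : E j `^ s <= (2 / m%:R) `^ s *
    (\sum_(l < m) b l `^ r / (dist l j).+1%:R ^+ 2 + N j `^ M).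
  apply: le_trans (powR_sum_le s0 G0 (card_near j (K j))) _.
  rewrite -/(N j) mulr_sumr.
  have H l : near j l -> N j `^ s * G l `^ s <= (2 / m%:R) `^ s *
      (b l `^ r / (dist l j).+1%:R ^+ 2 + N j `^ near_exponent r s).
    move=> jl; rewrite GE powRM ?divr_ge0// mulrCA ler_wpM2l ?powR_ge0//.
    have -> : b l `^ s = (b l `^ r) `^ th.
      by rewrite -powRrM /th mulrCA mulfV ?gt_eqF// mulr1.
    (* Here c is the r-th power of [b l], and D = dist + 1 is at most N because the distance is at
       most [K j]. *)
    rewrite mulrC; apply: powR_tradeoff => //.
    - exact: powR_ge0.
    - rewrite ler_nat ltnS (leq_trans jl)// -addnn leq_addr//.
    - by rewrite th0.
  apply: le_trans (ler_sum _ H) _.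
  rewrite -mulr_sumr ler_wpM2l ?powR_ge0// big_split/= lerD//.
    rewrite [leRHS](bigID (near j))/= lerDl sumr_ge0// => l _.
    by rewrite divr_ge0 ?powR_ge0// exprn_ge0.
  (* At most N bins are near j; this factor is the additional 1 in the exponent [M]. *)
  rewrite sumr_const -mulr_natl /M [in leRHS]powRD; last first.
    by rewrite (gt_eqF (lt_le_trans ltr01 (N1 j))) implybT.
  rewrite powRr1// mulrC ler_wpM2l ?powR_ge0// ler_nat.
  exact: card_near.
have main : m%:R^-1 * \sum_(j < m) E j `^ s <=
    (2 / m%:R) `^ s * (4 + m%:R^-1 * \sum_(j < m) N j `^ M).
  apply: (@le_trans _ _ (m%:R^-1 * \sum_(j < m) (2 / m%:R) `^ s *
    (\sum_(l < m) b l `^ r / (dist l j).+1%:R ^+ 2 + N j `^ M))).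
    by rewrite ler_wpM2l ?invr_ge0// ler_sum.
  rewrite -mulr_sumr mulrCA ler_wpM2l ?powR_ge0// big_split/= mulrDr lerD2r.
  (* With the sums exchanged, the inverse square distances charge each l with at most 4 times the
     r-th power of [b l]. *)
  rewrite ler_pdivrMl// exchange_big/= mulrC.
  apply: (@le_trans _ _ (\sum_(l < m) b l `^ r * 4)).
    apply: ler_sum => l _; rewrite -mulr_sumr ler_wpM2l ?powR_ge0//.
    exact: sum_inv_sqr_dist.
  by rewrite -mulr_suml; move: bS; lra.
apply: (@le_trans _ _ (((2 / m%:R) `^ s * (4 + m%:R^-1 * \sum_(j < m) N j `^ M)) `^ s^-1)).
  rewrite ge0_ler_powR ?nnegrE ?invr_ge0 ?(ltW s0)//.
  - by rewrite mulr_ge0 ?invr_ge0// sumr_ge0// => k _; exact: powR_ge0.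
  - apply: le_trans main.
    by rewrite mulr_ge0 ?invr_ge0// sumr_ge0// => k _; exact: powR_ge0.
have S4 : 4 <= 4 + m%:R^-1 * \sum_(j < m) N j `^ M.
  by rewrite lerDl mulr_ge0 ?invr_ge0// sumr_ge0// => k _; exact: powR_ge0.
rewrite powRM ?powR_ge0//; last by apply: le_trans S4.
rewrite -powRrM mulfV ?gt_eqF// powRr1 ?divr_ge0// ler_wpM2l ?divr_ge0//.
by rewrite ler1_powR ?invf_le1//; lra.
Qed.

End radius_upper_bounds.

(** * Lower bounds for the radius *)

Section fooling_functions.
Context {R : realType}.
Local Notation nu := (@leb01 R).
Implicit Types (f g h : R -> R) (r s t : R) (p q : \bar R).

Lemma Lp_norm_le_bins_set h m (S : {set 'I_m}) (e : R) p : (0 < m)%N ->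
  (1 <= p)%E -> 0 <= e -> measurable_fun setT h ->
  (forall (j : 'I_m) t, bin m j t -> `|h t| <= if j \in S then e else 0) ->
  (Lp_norm p h <= (e * (#|S|%:R / m%:R) `^ fine p^-1%E)%:E)%E.
Proof.
move=> m0 p1 e0 mh he; have E0 (j : 'I_m) : 0 <= if j \in S then e else 0.
  by case: ifP.
case: p p1 => [r| _|//]; last first.
  rewrite invey powRr0 mulr1; apply: (@Lp_normy_bins_le _ _ m) => // j t jm jt.
  by apply: (le_trans (he (Ordinal jm) t jt)); case: ifP.
rewrite lee_fin => r1; have r0 : 0 < r by exact: lt_le_trans r1.
apply: le_trans (Lp_norm_bins_le m0 r0 mh he E0) _; rewrite lee_fin.
rewrite (eq_bigr (fun j => if j \in S then e `^ r else 0)); last first.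
  by move=> j _; case: ifP => // _; rewrite powR0// gt_eqF.
rewrite -big_mkcond sumr_const -[e `^ r *+ _]mulr_natl mulrA [m%:R^-1 * _]mulrC.
rewrite fine_invE ?gt_eqF// powRM ?divr_ge0 ?powR_ge0//.
by rewrite -powRrM mulfV ?gt_eqF// powRr1// [leRHS]mulrC.
Qed.

Lemma Lp_norm_ge_bins_set h m (S : {set 'I_m}) (v : R) q :
  (1 <= q)%E -> 0 < v -> measurable_fun setT h -> S != finset.set0 ->
  (forall (j : 'I_m) t, j \in S -> (j%:R + 4^-1) / m%:R < t < (j%:R + 3 / 4) / m%:R ->
     v <= `|h t|) ->
  ((v * (#|S|%:R / m%:R / 2) `^ fine q^-1%E)%:E <= Lp_norm q h)%E.
Proof.
move=> q1 v0 mh /set0Pn[j0 j0S] hv.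
have m0 : (0 < m)%N by exact: leq_trans (ltn_ord j0).
have mR : (0 < m%:R :> R) by rewrite ltr0n.
(* The middle half of the bin, where a bell is comparable with its maximum; its share of the bin is
   the factor 1/2 in the bound. *)
pose mid (j : 'I_m) : set R := `](j%:R + 4^-1) / m%:R, (j%:R + 3 / 4) / m%:R[%classic.
have mmid j : measurable (mid j) by exact: measurable_itv.
have nmid j : nu (mid j) = (m%:R^-1 / 2)%:E.
  rewrite /mid leb01_itv//.
  - by congr EFin; field; rewrite gt_eqF.
  - by rewrite ltr_pM2r ?invr_gt0//; lra.
  - rewrite ler_pdivrMr// mul1r (@le_trans _ _ j.+1%:R)//.
      by rewrite -(natr1 j); lra.
    by rewrite ler_nat.
case: q q1 => [s| _|//]; last first.
  rewrite invey powRr0 mulr1 /Lp_norm unlock leb01T lte01.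
  rewrite leNgt; apply/negP => H.
  have [N [mN N0 NH]] := ess_sup_ge nu (abse \o (EFin \o h)).
  have : (nu (mid j0) <= nu N)%E.
    apply: le_measure; [by rewrite inE; exact: mmid|by rewrite inE|].
    move=> t; rewrite /mid /= in_itv/= => jt.
    apply: NH => /= ht; move: H; rewrite ltNge => /negP; apply.
    by apply: le_trans ht; rewrite lee_fin; exact: (hv j0).
  rewrite nmid [leRHS]N0 leNgt lte_fin => /negP; apply.
  by rewrite divr_gt0// invr_gt0.
rewrite lee_fin => s1; have s0 : 0 < s by exact: lt_le_trans s1.
have ms := measurable_powR_norm s mh.
have -> : Lp_norm s%:E h = ((\int[nu]_x (`|h x| `^ s)%:E) `^ s^-1)%E.
  by rewrite /Lp_norm unlock.
rewrite fine_invE ?gt_eqF//.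
have -> : v * (#|S|%:R / m%:R / 2) `^ s^-1 = (v `^ s * (#|S|%:R / m%:R / 2)) `^ s^-1.
  rewrite [RHS]powRM ?powR_ge0 ?divr_ge0// -powRrM mulfV ?gt_eqF// powRr1//.
  exact: ltW.
rewrite -poweR_EFin; apply: gt0_ler_poweR.
- by rewrite invr_ge0 ltW.
- by rewrite in_itv/= leey andbT lee_fin mulr_ge0 ?powR_ge0 ?divr_ge0.
- by rewrite in_itv/= leey andbT integral_ge0// => x _; rewrite lee_fin powR_ge0.
rewrite (ge0_integral_leb01_sum m0)// (bigID (mem S))/=.
apply: (@le_trans _ _ (\sum_(j in S) (v `^ s * (m%:R^-1 / 2))%:E)%E).
  rewrite sumEFin sumr_const lee_fin -mulr_natl.
  by rewrite le_eqVlt; apply/orP; left; apply/eqP; field; rewrite gt_eqF.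
apply: (@le_trans _ _ (\sum_(j in S) \int[nu]_(x in bin m j) (`|h x| `^ s)%:E)%E); last first.
  by rewrite leeDl// sume_ge0// => j _; exact: integral_ge0.
apply: lee_sum => j jS.
have mB := @measurable_bin R m j.
rewrite EFinM -(nmid j) -integral_cst; last exact: mmid.
apply: (@le_trans _ _ (\int[nu]_(x in mid j) (`|h x| `^ s)%:E)%E).
  apply: ge0_le_integral => //.
  - exact: mmid.
  - by move=> *; rewrite lee_fin powR_ge0.
  - exact: measurable_funS ms.
  - move=> x; rewrite /mid /= in_itv/= => jx; rewrite lee_fin.
    by rewrite ge0_ler_powR ?nnegrE// ?(ltW s0) ?(ltW v0)//; exact: (hv j).
apply: ge0_subset_integral => //; [exact: mmid|exact: measurable_funS ms|].
move=> x; rewrite /mid /bin /= !in_itv/= -(natr1 j) => /andP[x1 x2]; apply/andP; split.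
  by apply: le_lt_trans x1; rewrite ler_pM2r ?invr_gt0//; lra.
by apply: lt_le_trans x2 _; rewrite ler_pM2r ?invr_gt0//; lra.
Qed.

(** Both f and -f carry zero information, so phi answers the same [phi0] to both. Minkowski applied
    to 2 f = (f - phi0) + (f + phi0) shows that one of the two errors is at least [B]. *)
Lemma radius_ge_fooling p q n (x : 'I_n -> R) f (B : R) : (1 <= q)%E ->
  sobolev_ball p f -> sobolev_ball p (\- f) -> (forall i, f (x i) = 0) ->
  ((2 * B)%:E <= Lp_norm q (fun t => 2 * f t)%R)%E ->
  (B%:E <= radius_of_information p q x)%E.
Proof.
move=> q1 Bf BNf fx fB; apply: le_ereal_inf_tmp => _ [phi hphi <-].
set E := ereal_sup _.
have infoN : information x (\- f) = information x f.
  by apply/rowP => i; rewrite !mxE /= fx oppr0.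
set phi0 := phi (information x f).
have mf := sobolev_ball_measurable Bf.
have mphi : measurable_fun setT phi0.
  by have := hphi (information x f); rewrite inE => /andP[/[!inE]].
have E1 : (Lp_norm q (f \- phi0)%R <= E)%E by apply: ereal_sup_ubound; exists f.
have E2 : (Lp_norm q (f \+ phi0)%R <= E)%E.
  have -> : Lp_norm q (f \+ phi0) = Lp_norm q (\- f \- phi0).
    rewrite /Lp_norm -oppe_Lnorm; congr Lnorm; apply/funext => t /=.
    by rewrite opprD.
  by apply: ereal_sup_ubound; exists (\- f) => //; rewrite infoN.
have : ((2 * B)%:E <= E + E)%E.
  apply: (le_trans fB); apply: le_trans (leeD E1 E2).
  have -> : (fun t => 2 * f t) = ((f \- phi0) \+ (f \+ phi0)).
    by apply/funext => t /=; ring.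
  rewrite /Lp_norm; apply: eminkowski => //.
  - exact: measurable_funB.
  - exact: measurable_funD.
case: (E) => [e||]; rewrite ?leey//.
by rewrite -EFinD !lee_fin; lra.
Qed.

End fooling_functions.

(** * Smooth bells on bins and their weak derivatives *)

Section bumps.
Context {R : realType}.
Local Notation nu := (@leb01 R).
Implicit Types (f g h : R -> R) (a b r s t : R) (p q : \bar R).

(** A quartic on [a, b], C^1 across the endpoints as the square of a positive part. With w = b - a
    its height is w^4 / 16 and its slope is at most w^3 / 2. *)
Definition bell a b t : R := posr ((t - a) * (b - t)) ^+ 2.
Definition dbell a b t : R := 2 * posr ((t - a) * (b - t)) * (a + b - 2 * t).

Lemma is_derive_bell a b t : is_derive t 1 (bell a b) (dbell a b t).
Proof.
have D : is_derive t (1 : R) (fun x => (x - a) * (b - x)) (a + b - 2 * t).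
  have -> : (fun x => (x - a) * (b - x)) = (id - cst a) * (cst b - id) by [].
  by apply: is_derive_eq; rewrite /GRing.scale/= !fctE; ring.
exact: (@is_derive1_comp _ (fun x => posr x ^+ 2) _ _ _ _ (is_derive_sqr_posr _) D).
Qed.

Lemma continuous_dbell a b : continuous (dbell a b).
Proof.
move=> t; apply: cvgM.
  apply: cvgM; first exact: cvg_cst.
  apply: (@continuous_comp _ _ _ (fun x => (x - a) * (b - x)) posr); last exact: continuous_posr.
  by apply: cvgM; apply: cvgB; (exact: cvg_cst || exact: cvg_id).
by apply: cvgB; [exact: cvg_cst|apply: cvgM; [exact: cvg_cst|exact: cvg_id]].
Qed.

Definition bells m (A : R) (S : {set 'I_m}) t : R :=
  A * \sum_(j in S) bell (j%:R / m%:R) (j.+1%:R / m%:R) t.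
Definition dbells m (A : R) (S : {set 'I_m}) t : R :=
  A * \sum_(j in S) dbell (j%:R / m%:R) (j.+1%:R / m%:R) t.

Lemma is_derive_bells m A (S : {set 'I_m}) t :
  is_derive t 1 (bells A S) (dbells A S t).
Proof.
have -> : bells A S = A \*: (\sum_(j < m)
    if j \in S then bell (j%:R / m%:R) (j.+1%:R / m%:R) else cst 0).
  apply/funext => x; rewrite /bells big_mkcond/= /GRing.scale/=; congr (A * _).
  by rewrite fct_sumE; apply: eq_bigr => j _; case: ifP.
have H (j : 'I_m) : is_derive t (1 : R)
    (if j \in S then bell (j%:R / m%:R) (j.+1%:R / m%:R) else cst 0)
    (if j \in S then dbell (j%:R / m%:R) (j.+1%:R / m%:R) t else 0).
  by case: ifP => _; [exact: is_derive_bell|exact: is_derive_cst].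
apply: (is_derive_eq (is_deriveZ A (is_derive_sum H))).
by rewrite /dbells [in RHS]big_mkcond.
Qed.

Lemma continuous_sumr (I : Type) (r : seq I) (P : pred I) (F : I -> R -> R) :
  (forall i, continuous (F i)) -> continuous (fun t => \sum_(i <- r | P i) F i t).
Proof.
move=> cF; elim: r => [|i r IH].
  by under eq_fun do rewrite big_nil; move=> t; exact: cvg_cst.
under eq_fun do rewrite big_cons; case: (P i) => // t.
by apply: cvgD; [exact: cF|exact: IH].
Qed.

Lemma continuous_dbells m A (S : {set 'I_m}) : continuous (dbells A S).
Proof.
move=> t; apply: cvgM; first exact: cvg_cst.
by apply: continuous_sumr => j; exact: continuous_dbell.
Qed.

Lemma continuous_bells m A (S : {set 'I_m}) : continuous (bells A S).
Proof.
move=> t; apply: differentiable_continuous; apply/derivable1_diffP.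
by case: (is_derive_bells A S t).
Qed.

(** Integration by parts on [0, 1]; the boundary terms vanish because the support of [phi] lies in
    the open interval. *)
Lemma weak_derivative_C1 f g : (forall t, is_derive t 1 f (g t)) ->
  continuous g -> weak_derivative f g.
Proof.
move=> df cg phi [dphi cphi sphi].
have cont h k : (forall t, is_derive t (1 : R) h (k t)) -> continuous h.
  move=> dh t; apply: differentiable_continuous; apply/derivable1_diffP.
  by case: (dh t).
have cf : continuous f by exact: cont df.
have cphi0 : continuous phi.
  by move=> t; apply: differentiable_continuous; apply/derivable1_diffP.
have phi0 t : ~ (0 < t < 1) -> phi t = 0.
  move=> t01; apply/eqP; apply/negPn/negP => ht; apply: t01.
  by have := sphi t (@subset_closure _ [set x | phi x != 0] t ht); rewrite /= in_itv.
have LR h : continuous h -> (forall t, derivable h t 1) ->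
    derivable_oo_LRcontinuous h (0 : R) 1.
  move=> ch dh; split.
  - by move=> x _; exact: dh.
  - by apply: cvg_at_right_filter; exact: ch.
  - by apply: cvg_at_left_filter; exact: ch.
have mcont h : continuous h -> measurable_fun setT (EFin \o h).
  by move=> ch; apply/measurable_EFinP; exact: continuous_measurable_fun.
have toI h : continuous h ->
    \int[nu]_x h x = \int[@lebesgue_measure R]_(x in `[0, 1]) h x.
  by move=> ch; rewrite /Rintegral integral_leb01//; exact: mcont.
rewrite !toI; last 2 first.
- by move=> t; apply: cvgM; [exact: cg|exact: cphi0].
- by move=> t; apply: cvgM; [exact: cf|exact: cphi].
have df' t : derivable f t 1 by case: (df t).
rewrite (Rintegration_by_parts ltr01 (continuous_subspaceT cg) (LR f cf df') _
  (continuous_subspaceT cphi) (LR phi cphi0 dphi) (fun x _ => erefl)).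
- by rewrite !phi0 ?mulr0 ?subr0 ?sub0r ?ltxx ?andbF.
- by move=> x _; rewrite derive1E; case: (df x).
Qed.

End bumps.

Section radius_lower_bounds.
Context {R : realType}.
Local Notation nu := (@leb01 R).
Implicit Types (f g h : R -> R) (a b r s t : R) (p q : \bar R).

Lemma bell_out a b t : ~ (a < t < b) -> a <= b -> posr ((t - a) * (b - t)) = 0.
Proof.
move=> tab ab; apply: posr0; have [ta|ta] := lerP t a; first by nra.
have : b <= t by rewrite leNgt; apply/negP => tb; apply: tab; rewrite ta.
nra.
Qed.

Lemma bell_range a b t : a <= t <= b ->
  0 <= posr ((t - a) * (b - t)) <= (b - a) ^+ 2 / 4.
Proof.
move=> tab; rewrite posr_ge0/= posr_id; last by nra.
have := sqr_ge0 (t - a - (b - t)); nra.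
Qed.

(** Disjointness of the bins leaves at most one nonzero summand. Stated for a general [F] to serve
    both [bell] and [dbell]. *)
Lemma bin_sum m (S : {set 'I_m}) (F : R -> R -> R -> R) (j : 'I_m) t :
  (forall a b t, a <= b -> ~ (a < t < b) -> F a b t = 0) -> bin m j t ->
  \sum_(k in S) F (k%:R / m%:R) (k.+1%:R / m%:R) t =
  if j \in S then F (j%:R / m%:R) (j.+1%:R / m%:R) t else 0.
Proof.
move=> F0 jt; have m0 : (0 < m)%N by exact: leq_trans (ltn_ord j).
have FE (k : 'I_m) : k != j -> F (k%:R / m%:R) (k.+1%:R / m%:R) t = 0.
  move=> kj; apply: F0; first by rewrite ler_pM2r ?invr_gt0 ?ltr0n// ler_nat.
  move=> kt; move/eqP: kj; apply; apply/val_inj; apply: (@bin_inj _ _ _ _ t m0 _ jt).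
  by rewrite /bin /= in_itv.
case: ifPn => jS; last first.
  by rewrite big1// => k kS; apply: FE; apply: contraNneq jS => <-.
by rewrite (bigD1 j)//= big1 ?addr0// => k /andP[_]; exact: FE.
Qed.

Lemma width m (j : nat) : (0 < m)%N -> j.+1%:R / m%:R - j%:R / m%:R = m%:R^-1 :> R.
Proof.
by move=> m0; rewrite -mulrBl -natrB// subSnn mul1r.
Qed.

Lemma bells_bin m (A : R) (S : {set 'I_m}) (j : 'I_m) t : bin m j t ->
  bells A S t = if j \in S then
    A * posr ((t - j%:R / m%:R) * (j.+1%:R / m%:R - t)) ^+ 2 else 0.
Proof.
move=> jt; rewrite /bells (@bin_sum _ _ _ j)//; first by case: ifP; rewrite ?mulr0.
by move=> a b s ab sab; rewrite /bell bell_out// expr0n.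
Qed.

Lemma bells_le m (A : R) (S : {set 'I_m}) (j : 'I_m) t : bin m j t ->
  `|bells A S t| <= if j \in S then `|A| * (m%:R^-1 ^+ 4 / 16) else 0.
Proof.
move=> jt; have m0 : (0 < m)%N by exact: leq_trans (ltn_ord j).
rewrite (bells_bin _ _ jt); case: ifP; rewrite ?normr0// => _.
rewrite normrM ler_wpM2l// ger0_norm ?exprn_ge0 ?posr_ge0//.
move: jt; rewrite /bin /= in_itv/= => /andP[jt1 jt2].
have /bell_range : j%:R / m%:R <= t <= j.+1%:R / m%:R by rewrite !ltW.
rewrite width// => /andP[h0 h1].
have -> : m%:R^-1 ^+ 4 / 16 = (m%:R^-1 ^+ 2 / 4) ^+ 2 :> R by field; rewrite pnatr_eq0 -lt0n.
by rewrite lerXn2r// nnegrE// (le_trans h0).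
Qed.

Lemma dbells_le m (A : R) (S : {set 'I_m}) (j : 'I_m) t : bin m j t ->
  `|dbells A S t| <= if j \in S then `|A| * (m%:R^-1 ^+ 3 / 2) else 0.
Proof.
move=> jt; have m0 : (0 < m)%N by exact: leq_trans (ltn_ord j).
rewrite /dbells (@bin_sum _ _ _ j)//; last first.
  by move=> a b s ab sab; rewrite /dbell bell_out// mulr0 mul0r.
case: ifP; rewrite ?mulr0 ?normr0// => _; rewrite normrM ler_wpM2l//.
move: jt; rewrite /bin /= in_itv/= => /andP[jt1 jt2].
have /bell_range : j%:R / m%:R <= t <= j.+1%:R / m%:R by rewrite !ltW.
have wE := @width m j m0; rewrite wE => /andP[h0 h1]; rewrite /dbell.
have -> : m%:R^-1 ^+ 3 / 2 = (2 * (m%:R^-1 ^+ 2 / 4)) * m%:R^-1 :> R.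
  by field; rewrite pnatr_eq0 -lt0n.
rewrite normrM; apply: ler_pM => //; last by rewrite ler_norml; lra.
by rewrite ger0_norm ?mulr_ge0// ler_wpM2l.
Qed.

(** On the middle half the product of the distances to the two endpoints is at least 1/4 * 3/4 of
    the squared width, and (3/16)^2 = 9/256. *)
Lemma bells_ge m (A : R) (S : {set 'I_m}) (j : 'I_m) t : j \in S ->
  (j%:R + 4^-1) / m%:R < t < (j%:R + 3 / 4) / m%:R ->
  `|A| * (m%:R^-1 ^+ 4 * (9 / 256)) <= `|bells A S t|.
Proof.
move=> jS jt; have m0 : (0 < m)%N by exact: leq_trans (ltn_ord j).
have mR : (0 < m%:R^-1 :> R) by rewrite invr_gt0 ltr0n.
have wE := @width m j m0.
have e1 : (j%:R + 4^-1) / m%:R = j%:R / m%:R + m%:R^-1 / 4 :> R by ring.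
have e2 : (j%:R + 3 / 4) / m%:R = j%:R / m%:R + m%:R^-1 * 3 / 4 :> R by ring.
rewrite e1 e2 in jt.
have bjt : bin m j t by rewrite /bin /= in_itv/=; lra.
rewrite (bells_bin _ _ bjt) jS normrM ler_wpM2l// ger0_norm ?exprn_ge0 ?posr_ge0//.
have -> : m%:R^-1 ^+ 4 * (9 / 256) = (m%:R^-1 ^+ 2 * (3 / 16)) ^+ 2 :> R.
  by field; rewrite pnatr_eq0 -lt0n.
set x := t - _; set y := _ - t.
have xy : x + y = m%:R^-1 by rewrite /x /y; lra.
have [x1 y1] : m%:R^-1 / 4 <= x /\ m%:R^-1 / 4 <= y by rewrite /x /y; lra.
have xy2 : m%:R^-1 ^+ 2 * (3 / 16) <= x * y by rewrite -xy in x1 y1 *; nra.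
rewrite lerXn2r ?nnegrE ?posr_ge0//.
by rewrite posr_id// (le_trans _ xy2).
Qed.

(** For finite p = r two halves are enough because 2^(-r) + 2^(-r) <= 1 for r >= 1. *)
Lemma sobolev_ball_intro p f g : (1 <= p)%E -> (forall t, is_derive t 1 f (g t)) ->
  continuous g -> (Lp_norm p f <= (2^-1)%:E)%E -> (Lp_norm p g <= (2^-1)%:E)%E ->
  sobolev_ball p f.
Proof.
move=> p1 df cg Nf Ng.
have cf : continuous f.
  move=> t; apply: differentiable_continuous; apply/derivable1_diffP.
  by case: (df t).
have Lf h : continuous h -> (Lp_norm p h <= (2^-1)%:E)%E -> h \in Lfun nu p.
  move=> ch Nh; rewrite inE; apply/andP; split; rewrite inE/=.
    exact: continuous_measurable_fun.
  exact: le_lt_trans Nh (ltry _).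
exists g.
  split; [exact: Lf|exact: continuous_subspaceT|exact: Lf|exact: weak_derivative_C1].
case: p p1 Nf Ng {Lf} => [r| _|//]; last first.
  move=> Nf Ng; rewrite /sobolev_norm ge_max.
  by apply/andP; split; [apply: le_trans Nf _|apply: le_trans Ng _]; rewrite lee_fin; lra.
rewrite lee_fin => r1 Nf Ng; have r0 : 0 < r by exact: lt_le_trans r1.
have half h : (Lp_norm r%:E h <= (2^-1)%:E)%E -> (Lp_norm r%:E h `^ r <= (2^-1)%:E)%E.
  move=> Nh; apply: (@le_trans _ _ ((2^-1)%:E `^ r)%E).
    apply: gt0_ler_poweR => //; first exact: ltW.
      by rewrite in_itv/= Lnorm_ge0 leey.
    by rewrite in_itv/= leey andbT lee_fin.
  rewrite poweR_EFin lee_fin ge1r_powR//; lra.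
rewrite /sobolev_norm -(@poweR1r _ r^-1); apply: gt0_ler_poweR.
- by rewrite invr_ge0 ltW.
- by rewrite in_itv/= leey andbT adde_ge0// poweR_ge0.
- by rewrite in_itv/= leey lee01.
apply: (le_trans (leeD (half _ Nf) (half _ Ng))); rewrite -EFinD lee_fin; lra.
Qed.

Lemma radius_ge_bins p q n m (x : 'I_n -> R) (S : {set 'I_m}) :
  (1 <= p)%E -> (1 <= q)%E -> S != finset.set0 ->
  (forall i j, j \in S -> ~ bin m j (x i)) ->
  ((100^-1 / m%:R * (#|S|%:R / m%:R) `^ (fine q^-1%E - fine p^-1%E))%:E <=
    radius_of_information p q x)%E.
Proof.
move=> p1 q1 S0 xS.
have [j0 j0S] := set0Pn _ S0.
have m0 : (0 < m)%N by exact: leq_trans (ltn_ord j0).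
have mR : (0 < m%:R :> R) by rewrite ltr0n.
pose mu : R := #|S|%:R / m%:R.
have mu0 : 0 < mu by rewrite divr_gt0// ltr0n card_gt0.
(* The amplitude for which slopes of size D m^(-3) on a set of measure mu have L_p norm 1. The
   heights are then of order m^(-1) mu^(-1/p). *)
pose D := m%:R ^+ 3 * mu `^ (- fine p^-1%E).
have D0 : 0 < D by rewrite mulr_gt0 ?exprn_gt0 ?powR_gt0.
have DE : D * mu `^ fine p^-1%E = m%:R ^+ 3.
  rewrite /D -mulrA -powRD ?addNr ?powRr0 ?mulr1//.
  by rewrite (gt_eqF mu0) implybT.
have mle1 : m%:R^-1 <= 1 :> R by rewrite invf_le1// ler1n.
have mI0 : 0 < m%:R^-1 :> R by rewrite invr_gt0.
have mcont h : continuous h -> measurable_fun setT h by exact: continuous_measurable_fun.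
have ball A : `|A| = D -> sobolev_ball p (bells A S).
  move=> AD; apply: (sobolev_ball_intro p1 (is_derive_bells A S)).
  - exact: continuous_dbells.
  - apply: le_trans (Lp_norm_le_bins_set m0 p1 _ _ (bells_le A S)) _ => //.
    + by apply: mcont; exact: continuous_bells.
    + rewrite lee_fin mulrAC AD DE -/mu.
      have -> : m%:R ^+ 3 * (m%:R^-1 ^+ 4 / 16) = m%:R^-1 / 16 :> R.
        by field; rewrite gt_eqF.
      lra.
  - apply: le_trans (Lp_norm_le_bins_set m0 p1 _ _ (dbells_le A S)) _ => //.
    + by apply: mcont; exact: continuous_dbells.
    + rewrite lee_fin mulrAC AD DE.
      have -> : m%:R ^+ 3 * (m%:R^-1 ^+ 3 / 2) = 2^-1 :> R.
        by field; rewrite gt_eqF.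
      exact: lexx.
apply: (@radius_ge_fooling _ _ _ _ _ (bells D S)) => //.
- by apply: ball; rewrite gtr0_norm.
- have -> : \- bells D S = bells (- D) S.
    by apply/funext => t; rewrite /bells /= mulNr.
  by apply: ball; rewrite normrN gtr0_norm.
- move=> i; rewrite /bells big1 ?mulr0// => j jS; rewrite /bell bell_out ?expr0n//.
    by move=> h; apply: (xS i j jS); rewrite /bin /= in_itv.
  by rewrite ler_pM2r ?invr_gt0// ler_nat.
pose v := 2 * (D * (m%:R^-1 ^+ 4 * (9 / 256))).
have v0 : 0 < v.
  apply: mulr_gt0; first by lra.
  by apply: (mulr_gt0 D0); apply: mulr_gt0; [exact: exprn_gt0|lra].
apply: le_trans (Lp_norm_ge_bins_set (v := v) q1 v0 _ S0 _); last 2 first.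
- by apply: mcont => t; apply: cvgM; [exact: cvg_cst|exact: continuous_bells].
- move=> j t jS jt; rewrite /v normrM ger0_norm// ler_pM2l//.
  by apply: le_trans (bells_ge D jS jt); rewrite gtr0_norm.
rewrite lee_fin -/mu /v -[leRHS]mulrA ler_pM2l//.
rewrite (powRM _ (ltW mu0)) ?invr_ge0//.
rewrite (@powRD _ _ (fine q^-1%E)); last by apply/implyP => _; rewrite gt_eqF.
rewrite /D; set X := mu `^ fine q^-1%E; set Y := mu `^ (- fine p^-1%E).
have X0 : 0 <= X by exact: powR_ge0.
have Y0 : 0 <= Y by exact: powR_ge0.
(* The middle halves cost 2^(-1/q) >= 1/2, and 9/256 * 1/2 exceeds 1/100. *)
have h2 : 2^-1 <= 2^-1 `^ fine q^-1%E :> R.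
  rewrite ger1_powR//; first by lra.
  case: (q) q1 => [s| _|//]; last by rewrite invey.
  rewrite lee_fin => s1; rewrite fine_invE ?gt_eqF ?(lt_le_trans ltr01)//.
  by rewrite invf_le1// (lt_le_trans ltr01).
rewrite (_ : m%:R ^+ 3 * Y * _ * _ = (m%:R^-1 * (X * Y)) * (9 / 256 * 2^-1 `^ fine q^-1%E)); last first.
  by field; rewrite gt_eqF.
rewrite (_ : 100^-1 / m%:R * _ = (m%:R^-1 * (X * Y)) * 100^-1); last by field; rewrite gt_eqF.
rewrite ler_wpM2l ?mulr_ge0 ?(ltW mI0)//.
lra.
Qed.

End radius_lower_bounds.

(** * Random points *)

Section random_points.
Context {R : realType} d (T : measurableType d) (P : probability T R) (n : nat)
  (X : 'I_n -> {RV P >-> R}).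
Context (hX : iid_uniform X).
Local Notation nu := (@leb01 R).

Lemma uniform_probE (A : set R) : measurable A ->
  uniform_prob (@ltr01 R) A = nu A.
Proof.
move=> mA; rewrite /uniform_prob integral_uniform_pdf.
rewrite (eq_integral (cst 1%E)); last first.
  move=> t; rewrite inE /= in_itv/= => -[_ t01].
  by rewrite /uniform_pdf t01 subr0 invr1.
by rewrite integral_cst ?mul1e//; exact: measurableI.
Qed.

Definition miss m (S : {set 'I_m}) : set T := [set w | forall i, ~ bins S (X i w)].

Lemma missE m (S : {set 'I_m}) :
  miss S = \bigcap_(i in [set` [set: 'I_n]%SET]) X i @^-1` (~` bins S).
Proof.
by apply/seteqP; split => w h i; [move=> _; exact: h|apply: h; rewrite /= finset.inE].
Qed.

Lemma measurable_miss m (S : {set 'I_m}) : measurable (miss S).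
Proof.
rewrite missE; apply: fin_bigcap_measurable; first exact: finite_finset.
move=> i _; rewrite -[X in measurable X]setTI; apply: measurable_funPT => //.
by apply: measurableC; exact: measurable_bins.
Qed.

Lemma prob_miss m (S : {set 'I_m}) : (0 < m)%N ->
  P (miss S) = ((1 - #|S|%:R / m%:R) ^+ n)%:E.
Proof.
move=> m0; have mC : measurable (~` bins S : set R).
  by apply: measurableC; exact: measurable_bins.
rewrite missE hX.1//.
rewrite (eq_bigr (fun=> (1 - #|S|%:R / m%:R)%:E)); last first.
  move=> i _; rewrite -[LHS]/(distribution P (X i) (~` bins S)) hX.2// uniform_probE//.
  have mB := @measurable_bins R m S.
  have e1 : (1%E = nu (bins S) + nu (~` bins S))%E.
    by rewrite -(@leb01T R) -measureU ?setICr ?setUCr.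
  rewrite leb01_bins in e1.
  have : nu (~` bins S) \is a fin_num by rewrite ge0_fin_numE// leb01_fin.
  move: e1; case: (nu (~` bins S)) => [r||]// [] e _.
  by congr EFin; apply/esym/eqP; rewrite subr_eq addrC; apply/eqP.
by rewrite prodEFin prodr_const cardsT card_ord.
Qed.

Lemma integral_indic_sum (I : finType) (c q : I -> R) (E : I -> set T) :
  (forall i, measurable (E i)) -> (forall i, P (E i) = (q i)%:E) ->
  P.-integrable setT (fun w => (\sum_i c i * \1_(E i) w)%:E) /\
  (\int[P]_w (\sum_i c i * \1_(E i) w)%:E = (\sum_i c i * q i)%:E)%E.
Proof.
move=> mE PE; have H i : P.-integrable setT (fun w => (c i)%:E * (\1_(E i) w)%:E)%E.
  by apply: (integrableZl measurableT); exact: integrable_indic.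
have -> : (fun w => (\sum_i c i * \1_(E i) w)%:E) =
    (fun w => \sum_i (c i)%:E * (\1_(E i) w)%:E)%E.
  by apply/funext => w; rewrite sumEFin.
split; first exact: integrable_sum.
rewrite integral_sum// -sumEFin; apply: eq_bigr => i _.
rewrite integralZl//; last exact: integrable_indic.
by rewrite EFinM; congr (_ * _)%E; rewrite integral_indic// setIT; exact: PE.
Qed.

(** The form in which the expected radius is bounded above: a pointwise bound by weighted indicators
    becomes a weighted sum of probabilities. *)
Lemma lower_integral_le_indic (I : finType) (f : T -> \bar R) (c q : I -> R)
    (E : I -> set T) :
  (forall i, measurable (E i)) -> (forall i, P (E i) = (q i)%:E) ->
  (forall w, 0 <= f w)%E -> (forall w, f w <= (\sum_i c i * \1_(E i) w)%:E)%E ->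
  (\int[P]_w f w <= (\sum_i c i * q i)%:E)%E.
Proof.
move=> mE PE f0 fE; have [_ <-] := integral_indic_sum c mE PE.
exact: lower_integral_le.
Qed.

(* Second moment method: if Z counts the empty bins, the indicator of Z > 0 is at
   least 2 a Z - (a Z)^2, and a = 1 / (1 + E Z) is a good choice. *)
Lemma prob_some_miss m : (1 < m)%N -> 1 <= m%:R * (1 - m%:R^-1) ^+ n :> R ->
  (2^-1%:E <= P (\bigcup_(j in [set: 'I_m]) miss [set j]%SET))%E.
Proof.
move=> m1; set x := (1 - m%:R^-1) ^+ n => u1; have m0 := ltnW m1.
have mR : (0 < m%:R :> R) by rewrite ltr0n.
set A := \bigcup_(j in _) _.
have mA : measurable A.
  by apply: fin_bigcup_measurable => // j _; exact: measurable_miss.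
pose u : R := m%:R * x.
pose a : R := (1 + u)^-1.
have a0 : 0 < a by rewrite invr_gt0; rewrite -/u in u1; lra.
pose q (jk : 'I_m * 'I_m) : R := (1 - #|[set jk.1; jk.2]%SET|%:R / m%:R) ^+ n.
(* Coefficients of 2 a Z - (a Z)^2 expanded over pairs of bins; the linear term sits on the
   diagonal, where an indicator equals its square. *)
pose c (jk : 'I_m * 'I_m) : R := (if jk.1 == jk.2 then 2 * a else 0) - a ^+ 2.
have [intc Ic] := @integral_indic_sum _ c q (fun jk => miss [set jk.1; jk.2]%SET)
  (fun jk => measurable_miss _) (fun jk => prob_miss _ m0).
have x_ge0 : 0 <= x by rewrite exprn_ge0// subr_ge0 invf_le1// ler1n.
have low : 2^-1 <= \sum_jk c jk * q jk.
  rewrite -(pair_bigA _ (fun j k => c (j, k) * q (j, k)))/=.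
  apply: (@le_trans _ _ (\sum_(j < m) (2 * a * x - a ^+ 2 * (x + m%:R * x ^+ 2)))).
    rewrite sumr_const card_ord -[_ *+ m]mulr_natl.
    rewrite (_ : m%:R * _ = 2 * a * u - a ^+ 2 * (u + u ^+ 2)); last by rewrite /u; ring.
    have -> : 2 * a * u - a ^+ 2 * (u + u ^+ 2) = u / (1 + u).
      by rewrite /a; field; rewrite -/u in u1; lra.
    by rewrite -/u in u1; rewrite ler_pdivlMr; lra.
  apply: ler_sum => j _; rewrite (bigD1 j)//= /c /q /= eqxx finset.setUid cards1.
  rewrite div1r -/x.
  suff : - (a ^+ 2 * (m%:R * x ^+ 2)) <=
      \sum_(k < m | k != j) c (j, k) * q (j, k) by rewrite /c /q /=; lra.
  apply: (@le_trans _ _ (\sum_(k < m | k != j) - (a ^+ 2 * x ^+ 2))).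
    rewrite sumrN lerN2 sumr_const -[_ *+ #|_|]mulr_natl mulrCA.
    rewrite ler_wpM2l ?sqr_ge0// ler_wpM2r ?sqr_ge0// ler_nat.
    by rewrite -[leqRHS](card_ord m) max_card.
  apply: ler_sum => k kj; rewrite /c /q /= eq_sym (negbTE kj) sub0r mulNr lerN2.
  (* Emptiness of two distinct bins is negatively correlated: 1 - 2/m <= (1 - 1/m)^2. *)
  rewrite ler_wpM2l ?sqr_ge0// cards2 eq_sym kj /x exprAC /=.
  rewrite lerXn2r ?nnegrE ?sqr_ge0//.
    by rewrite subr_ge0 ler_pdivrMr// mul1r ler_nat.
  by have := sqr_ge0 (m%:R^-1 : R); lra.
apply: (@le_trans _ _ (\int[P]_w (\sum_jk c jk * \1_(miss [set jk.1; jk.2]%SET) w)%:E)%E).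
  by rewrite Ic lee_fin.
have -> : P A = (\int[P]_w (\1_A w)%:E)%E by rewrite integral_indic// setIT.
apply: le_integral => //.
  exact: integrable_indic.
move=> w _; rewrite lee_fin.
have mU (j k : 'I_m) : miss [set j; k]%SET = miss [set j]%SET `&` miss [set k]%SET.
  apply/seteqP; split => v /=.
    move=> H; split=> i /binsP[l]; rewrite finset.inE => /eqP -> vl; apply: (H i).
      by apply/binsP; exists j => //; rewrite !finset.inE eqxx.
    by apply/binsP; exists k => //; rewrite !finset.inE eqxx orbT.
  move=> [Hj Hk] i /binsP[l]; rewrite !finset.inE => /orP[] /eqP -> vl.
    by apply: (Hj i); apply/binsP; exists j => //; rewrite finset.inE.
  by apply: (Hk i); apply/binsP; exists k => //; rewrite finset.inE.
pose b (j : 'I_m) : R := \1_(miss [set j]%SET) w.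
have bE j k : \1_(miss [set j; k]%SET) w = b j * b k by rewrite mU indicI.
have b01 j : b j = 0 \/ b j = 1.
  by rewrite /b indicE; case: (_ \in _); [right|left].
have [wA|wA] := pselect (A w); last first.
  rewrite indicE memNset// big1// => -[j k] _.
  rewrite bE /b indicE memNset ?mul0r ?mulr0// => wj; apply: wA.
  by exists j.
rewrite indicE mem_set//.
rewrite -(pair_bigA _ (fun j k => c (j, k) * \1_(miss [set j; k]%SET) w))/=.
rewrite (eq_bigr (fun j => 2 * a * b j - a ^+ 2 * (b j * \sum_k b k))); last first.
  move=> j _; rewrite (bigD1 j)//= [in RHS](bigD1 j)//= /c /= eqxx bE.
  rewrite (eq_bigr (fun k => - a ^+ 2 * b j * b k)); last first.
    by move=> k kj; rewrite eq_sym (negbTE kj) bE; ring.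
  have bb : b j * b j = b j by case: (b01 j) => ->; rewrite ?mulr0 ?mulr1.
  by rewrite -mulr_sumr (mulrDr (b j)) !bb; ring.
rewrite sumrB -mulr_sumr -mulr_sumr -mulr_suml.
(* What remains is 2 a z - (a z)^2 <= 1, that is, (1 - a z)^2 >= 0. *)
set z := \sum_(i < m) b i; have := sqr_ge0 (1 - a * z); rewrite /=; lra.
Qed.

End random_points.

(** * Expected radius for p <= q *)

Section expected_radius_bounds.
Context {R : realType} d (T : measurableType d) (P : probability T R) (n : nat)
  (X : 'I_n -> {RV P >-> R}).
Context (hX : iid_uniform X) (p q : \bar R) (p1 : (1 <= p)%E) (q1 : (1 <= q)%E).
Local Notation points := (fun w => fun i => X i w).

Lemma radius_ge0 k (x : 'I_k -> R) : (0 <= radius_of_information p q x)%E.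
Proof.
apply: le_ereal_inf_tmp => _ [phi _ <-].
have B0 : sobolev_ball p (fun=> 0 : R).
  apply: (@sobolev_ball_intro _ _ (cst 0) (cst 0)) => //.
  - by move=> t; exact: cvg_cst.
  - by rewrite /Lp_norm Lnorm0 ?lee_fin ?gt_eqF// (lt_le_trans _ p1).
  - by rewrite /Lp_norm Lnorm0 ?lee_fin ?gt_eqF// (lt_le_trans _ p1).
apply: ereal_sup_ge; exists (Lp_norm q ((fun=> 0) \- phi (information x (fun=> 0)))).
  by exists (fun=> 0).
exact: Lnorm_ge0.
Qed.

Lemma expected_radius_ge (B : R) : (forall x : 'I_n -> R, B%:E <= radius_of_information p q x)%E ->
  (B%:E <= expected_radius p q X)%E.
Proof.
move=> H; have [B0|/ltW B0] := lerP 0 B; last first.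
  by apply: (@le_trans _ _ 0%E); rewrite ?lee_fin// integral_ge0// => w _; exact: radius_ge0.
rewrite /expected_radius -[leLHS]mule1 -(@probability_setT _ _ _ P) -integral_cst//.
by apply: lower_integral_le => w; [rewrite lee_fin|exact: H].
Qed.

Lemma expected_radius_occupied m : (0 < m)%N -> (p <= q)%E ->
  (expected_radius p q X <=
    (2 * m%:R `^ (-1 + fine p^-1%E - fine q^-1%E) +
     4 * (m%:R * (1 - m%:R^-1) ^+ n))%:E)%E.
Proof.
move=> m0 pq; set rho := _ `^ _.
have rho0 : 0 <= rho by exact: powR_ge0.
(* Union bound: [inl] carries the bound valid when every bin is hit, [inr j] adds the trivial bound
   4 on the event that bin j is empty. *)
pose c (o : 'I_1 + 'I_m) : R := if o is inl _ then 2 * rho else 4.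
pose E (o : 'I_1 + 'I_m) := if o is inr j then miss X [set j]%SET else setT.
pose pr (o : 'I_1 + 'I_m) : R := if o is inr _ then (1 - m%:R^-1) ^+ n else 1.
have -> : 2 * rho + 4 * (m%:R * (1 - m%:R^-1) ^+ n) = \sum_o c o * pr o.
  rewrite big_sumType/= big_ord1 mulr1 sumr_const card_ord -[in RHS]mulr_natl.
  by congr (_ + _); ring.
have cE0 (o : 'I_1 + 'I_m) w : 0 <= c o * \1_(E o) w.
  by rewrite mulr_ge0//; case: o => //=; rewrite mulr_ge0.
apply: (@lower_integral_le_indic _ _ _ P _ _ c pr E).
- by move=> [i|j] //=; exact: measurable_miss.
- move=> [i|j] /=; first by rewrite probability_setT.
  by rewrite prob_miss// cards1 div1r.
- by move=> w; exact: radius_ge0.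
move=> w; rewrite big_sumType /= big_ord1 indicT mulr1.
have [/existsP[j /asboolP wj]|/existsPn H] := boolP [exists j : 'I_m, `[< miss X [set j]%SET w >]].
  apply: (le_trans (radius_le4 _ p1 q1)); rewrite lee_fin (bigD1 j)//=.
  rewrite indicE mem_set// mulr1 addrCA lerDl addr_ge0 ?mulr_ge0//.
  by apply: sumr_ge0 => i _; exact: (cE0 (inr i)).
apply: (@le_trans _ _ (2 * rho)%:E); last first.
  by rewrite lee_fin lerDl; apply: sumr_ge0 => i _; exact: (cE0 (inr i)).
apply: radius_occupied => // j; apply: contrapT => nj; move/asboolP: (H j); apply.
move=> i /binsP[l]; rewrite finset.inE => /eqP -> ji.
by apply: nj; exists i.
Qed.

(** With probability at least 1/2 some bin is empty, and a single empty bin forces a radius of 1/100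
    times the rate. *)
Lemma expected_radius_some_miss m : (1 < m)%N ->
  1 <= m%:R * (1 - m%:R^-1) ^+ n :> R ->
  ((200^-1 * m%:R `^ (-1 + fine p^-1%E - fine q^-1%E))%:E <= expected_radius p q X)%E.
Proof.
move=> m1 u1; have m0 := ltnW m1; have mR : (0 < m%:R :> R) by rewrite ltr0n.
set rho := _ `^ _.
have rhoE : m%:R^-1 * (1 / m%:R) `^ (fine q^-1%E - fine p^-1%E) = rho.
  rewrite div1r -{1}[m%:R^-1]powR_inv1// -[m%:R^-1]powR_inv1// -powRrM -powRD.
    by congr (_ `^ _); ring.
  by rewrite (gt_eqF mR) implybT.
set A := \bigcup_(j in [set: 'I_m]) miss X [set j]%SET.
have mA : measurable A.
  by apply: fin_bigcup_measurable => // j _; exact: measurable_miss.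
have := prob_some_miss hX m1 u1; rewrite -/A => PA.
have rA w : ((100^-1 * rho)%:E * (\1_A w)%:E <= radius_of_information p q (points w))%E.
  have [wA|wA] := pselect (A w); last by rewrite indicE memNset// mule0 radius_ge0.
  rewrite indicE mem_set// mule1.
  have [j _ wj] := wA.
  have := @radius_ge_bins _ p q n m (points w) [set j]%SET p1 q1.
  rewrite cards1 -mulrA rhoE; apply.
    by apply/set0Pn; exists j; rewrite finset.inE.
  by move=> i k kj ki; apply: (wj i); apply/binsP; exists k.
apply: (@le_trans _ _ (\int[P]_w ((100^-1 * rho)%:E * (\1_A w)%:E))%E); last first.
  apply: lower_integral_le => // w.
  by rewrite mule_ge0// lee_fin mulr_ge0// powR_ge0.
rewrite ge0_integralZl//; last 2 first.
- by apply/measurable_EFinP; exact: measurable_indic.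
- by rewrite lee_fin mulr_ge0// powR_ge0.
rewrite integral_indic// setIT.
apply: le_trans (lee_wpmul2l _ PA); last by rewrite lee_fin mulr_ge0// powR_ge0.
by rewrite -EFinM lee_fin le_eqVlt; apply/orP; left; apply/eqP; field.
Qed.

End expected_radius_bounds.

(** * Expected radius for q < p: tails of the gaps *)

Section windows.
Context {R : realType}.

Definition window m (j : 'I_m) k : {set 'I_m} := [set l : 'I_m | (dist l j < k)%N]%SET.

(** Near the ends of [0, 1] a window is cut off on one side, but it still contains the k consecutive
    indices from min(j, m - k) on. *)
Lemma card_window m (j : 'I_m) k : (k <= m)%N -> (k <= #|window j k|)%N.
Proof.
move=> km; pose a := minn j (m - k).
rewrite cardE -(size_map val) -[leqLHS](size_iota a k).
apply: uniq_leq_size; first exact: iota_uniq.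
move=> l; rewrite mem_iota => /andP[al lk].
have lm : (l < m)%N by move: al lk; rewrite /a; have := ltn_ord j; lia.
apply/mapP; exists (Ordinal lm) => //; rewrite mem_enum inE /dist /=.
by move: al lk; rewrite /a; have := ltn_ord j; lia.
Qed.

Lemma onem_le_expR (x : R) (n : nat) : x <= 1 -> (1 - x) ^+ n <= expR (- (x * n%:R)).
Proof.
move=> x1; rewrite -mulNr expRM_natr lerXn2r ?nnegrE ?expR_ge0 ?subr_ge0//.
exact: expR_ge1Dx.
Qed.

(** From 2k + 1 <= 4M exp(k / (2M)), the M-th power costs only exp(k/2), and a geometric series of
    ratio exp(-1/2) is left. *)
Lemma sum_powR_exp_le (M : R) : 1 <= M -> exists2 C : R, 0 <= C &
  forall m, \sum_(k < m) k.*2.+1%:R `^ M * expR (- k%:R) <= C.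
Proof.
move=> M1; have M0 : 0 < M by exact: lt_le_trans M1.
pose x : R := expR (- 2^-1).
have x1 : x < 1 by rewrite /x expR_lt1; lra.
have x0 : 0 <= x by exact: expR_ge0.
exists ((4 * M) `^ M / (1 - x)); first by rewrite divr_ge0 ?powR_ge0// subr_ge0 ltW.
move=> m; apply: (@le_trans _ _ (\sum_(k < m) (4 * M) `^ M * x ^+ k)).
  apply: ler_sum => k _.
  have H : k.*2.+1%:R <= 4 * M * expR (k%:R / (2 * M)).
    apply: (@le_trans _ _ (4 * M * (1 + k%:R / (2 * M)))).
      rewrite mulrDr mulr1 (_ : 4 * M * _ = k%:R * 2); last by field; rewrite gt_eqF.
      by rewrite -natr1 -muln2 natrM; lra.
    by rewrite ler_wpM2l ?expR_ge1Dx// mulr_ge0// ltW.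
  apply: (@le_trans _ _ ((4 * M * expR (k%:R / (2 * M))) `^ M * expR (- k%:R))).
    rewrite ler_wpM2r ?expR_ge0// ge0_ler_powR ?nnegrE ?(ltW M0)//.
    exact: le_trans H.
  rewrite powRM ?mulr_ge0 ?expR_ge0 ?(ltW M0)// -mulrA ler_wpM2l ?powR_ge0//.
  rewrite -expRM -expRD /x -expRM_natr le_eqVlt; apply/orP; left; apply/eqP.
  by congr expR; field; rewrite gt_eqF.
rewrite -mulr_sumr ler_wpM2l ?powR_ge0//.
rewrite -[leRHS]div1r ler_pdivlMr ?subr_gt0//.
have := subrX1 x m; have : 0 <= x ^+ m by exact: exprn_ge0.
by rewrite [_ * (1 - x)]mulrC -[1 - x]opprB mulNr => h <-; lra.
Qed.

End windows.

Section expected_radius_nearest.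
Context {R : realType} d (T : measurableType d) (P : probability T R) (n : nat)
  (X : 'I_n -> {RV P >-> R}).
Context (hX : iid_uniform X) (p : \bar R) (s r : R) (p1 : (1 <= p)%E) (s1 : 1 <= s)
  (sr : s < r) (pr : p = r%:E \/ p = +oo%E) (n0 : (0 < n)%N).

Lemma near_exponent_ge1 : 1 <= near_exponent r s + 1.
Proof.
rewrite lerDr /near_exponent divr_ge0//; first by have := s1; lra.
rewrite subr_ge0 ler_pdivrMr ?mul1r; first exact: ltW.
by have := s1; have := sr; lra.
Qed.

(** Takes for [K j] the distance from j to the nearest occupied bin. Summing over all possible
    values k, each with the indicator of an empty window, replaces this random distance by events of
    known probability. *)
Lemma radius_windows w : ~ miss X [set: 'I_n]%SET w ->
  (radius_of_information p s%:E (fun i => X i w) <= (2 / n%:R *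
    (4 + n%:R^-1 * \sum_(jk : 'I_n * 'I_n) jk.2.*2.+1%:R `^ (near_exponent r s + 1) *
      \1_(miss X (window jk.1 jk.2)) w))%:E)%E.
Proof.
move=> /existsNP[i0 /contrapT/binsP[l0 _ l0i]].
pose occ (l : 'I_n) := `[< exists i, bin n l (X i w) >].
have occ0 : occ l0 by apply/asboolP; exists i0.
pose c (j : 'I_n) := [arg min_(l < l0 | occ l) dist l j].
have cP (j : 'I_n) : occ (c j) /\ forall l, occ l -> (dist (c j) j <= dist l j)%N.
  by rewrite /c; case: arg_minnP => // l ol H; split.
have distC (a b : nat) : dist a b = dist b a by rewrite /dist addnC.
pose K (j : 'I_n) := dist (c j) j.
have Kn (j : 'I_n) : (K j < n)%N.
  by rewrite /K /dist; have := ltn_ord j; have := ltn_ord (c j); lia.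
have := @radius_nearest _ p s n n (fun i => X i w) r K c n0 s1 sr pr.
move=> /(_ _ _)/le_trans; apply.
- by move=> j; have [/asboolP] := cP j.
- by move=> j; rewrite distC.
rewrite lee_fin ler_wpM2l ?divr_ge0// lerD2l ler_wpM2l ?invr_ge0//.
rewrite -(pair_bigA _ (fun j k : 'I_n => k.*2.+1%:R `^ (near_exponent r s + 1) *
      \1_(miss X (window j k)) w))/=.
(* The term k = [K j] alone suffices: [window] uses a strict inequality, so the window of radius
   [K j] excludes the nearest occupied bin and is empty of samples. *)
apply: ler_sum => j _; rewrite (bigD1 (Ordinal (Kn j)))//=.
rewrite indicE mem_set ?mulr1.
  by rewrite lerDl sumr_ge0// => k _; rewrite mulr_ge0// powR_ge0.
move=> i /binsP[l]; rewrite inE => lK il.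
have [_ /(_ l)] := cP j; rewrite -/(K j) leqNgt lK => /implyP; rewrite implybF => /negP.
by apply; apply/asboolP; exists i.
Qed.

Lemma expected_radius_nearest (C : R) :
  (forall m, \sum_(k < m) k.*2.+1%:R `^ (near_exponent r s + 1) * expR (- k%:R) <= C) ->
  (expected_radius p s%:E X <= ((8 + 2 * C) / n%:R)%:E)%E.
Proof.
move=> HC; have nR : (0 < n%:R :> R) by rewrite ltr0n.
have q1 : (1 <= s%:E)%E by rewrite lee_fin.
set M := near_exponent r s + 1.
(* The two left indices are the constant 2/n * 4 and the null event that all samples are bin
   endpoints or lie outside [0, 1], where the bound 4 is used; the pairs are the windows. *)
pose c (o : 'I_2 + 'I_n * 'I_n) : R := match o with
  | inl i => if val i == 0%N then 8 / n%:R else 4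
  | inr jk => 2 / n%:R / n%:R * jk.2.*2.+1%:R `^ M end.
pose E (o : 'I_2 + 'I_n * 'I_n) := match o with
  | inl i => if val i == 0%N then setT else miss X [set: 'I_n]%SET
  | inr jk => miss X (window jk.1 jk.2) end.
pose q (o : 'I_2 + 'I_n * 'I_n) : R := match o with
  | inl i => if val i == 0%N then 1 else 0
  | inr jk => (1 - #|window jk.1 jk.2|%:R / n%:R) ^+ n end.
have cE0 o w : 0 <= c o * \1_(E o) w.
  rewrite mulr_ge0//; case: o => /= [i|jk]; last by rewrite mulr_ge0 ?divr_ge0// powR_ge0.
  by case: ifP => // _; rewrite divr_ge0.
have H : (expected_radius p s%:E X <= (\sum_o c o * q o)%:E)%E.
  apply: (@lower_integral_le_indic _ _ _ P _ _ c q E).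
  - by move=> [i|jk] /=; [case: ifP => _ //|]; exact: measurable_miss.
  - move=> [i|jk] /=; last by rewrite prob_miss.
    case: ifP => _; first by rewrite probability_setT.
    rewrite prob_miss// cardsT card_ord divff ?gt_eqF// subrr expr0n.
    by rewrite eqn0Ngt n0.
  - by move=> w; exact: radius_ge0.
  move=> w; have [wA|wA] := pselect (miss X [set: 'I_n]%SET w).
    apply: (le_trans (radius_le4 _ p1 q1)).
    rewrite lee_fin (bigD1 (inl (@Ordinal 2 1 isT)))//= indicE mem_set// mulr1.
    by rewrite lerDl; apply: sumr_ge0 => o _.
  apply: (le_trans (radius_windows wA)); rewrite lee_fin big_sumType/=.
  rewrite big_ord_recl/= big_ord1/= indicT mulr1 indicE memNset// mulr0 addr0.
  rewrite mulrDr mulrA mulr_sumr.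
  rewrite (_ : 2 / n%:R * 4 = 8 / n%:R); last by field; rewrite gt_eqF.
  rewrite lerD2l; apply: ler_sum => jk _.
  by rewrite mulrA.
apply: (le_trans H); rewrite lee_fin big_sumType/=.
rewrite big_ord_recl/= big_ord1/= mulr1 mulr0 addr0 [leRHS]mulrDl lerD2l.
rewrite -(pair_bigA _ (fun j k : 'I_n => 2 / n%:R / n%:R * k.*2.+1%:R `^ M *
  (1 - #|window j k|%:R / n%:R) ^+ n))/=.
apply: (@le_trans _ _ (\sum_(j < n) 2 / n%:R / n%:R * C)); last first.
  rewrite sumr_const card_ord -[_ *+ n]mulr_natl le_eqVlt; apply/orP; left; apply/eqP.
  by field; rewrite gt_eqF.
apply: ler_sum => j _; apply: le_trans (ler_wpM2l _ (HC n)); last first.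
  by rewrite !divr_ge0.
rewrite mulr_sumr; apply: ler_sum => k _; rewrite -mulrA.
rewrite ler_wpM2l ?divr_ge0// ler_wpM2l ?powR_ge0//.
have W1 : #|window j k|%:R / n%:R <= 1 :> R.
  by rewrite ler_pdivrMr// mul1r ler_nat -[leqRHS](card_ord n) max_card.
(* A window of at least k bins is missed with probability at most (1 - k/n)^n <= exp(-k). *)
apply: (le_trans (onem_le_expR n W1)); rewrite ler_expR lerN2 divfK ?gt_eqF//.
by rewrite ler_nat card_window// ltnW.
Qed.

End expected_radius_nearest.

(** * Radius of optimal information *)

Section rates.
Context {R : realType}.
Implicit Types (p q : \bar R).

Lemma fine_inve01 p : (1 <= p)%E -> 0 <= fine p^-1%E <= 1.
Proof.
case: p => [r| _|//]; last by rewrite invey lexx ler01.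
rewrite lee_fin => r1; have r0 : 0 < r by exact: lt_le_trans r1.
by rewrite fine_invE ?gt_eqF// invr_ge0 (ltW r0) invf_le1.
Qed.

Lemma fine_inve_le p q : (1 <= p)%E -> (p <= q)%E -> fine q^-1%E <= fine p^-1%E.
Proof.
move=> p1 pq; have q1 : (1 <= q)%E by exact: le_trans pq.
case: q pq q1 => [s| _ _|//]; last by rewrite invey; have /andP[] := fine_inve01 p1.
case: p p1 => [r| |//]; last by move=> _; rewrite leNgt ltry.
rewrite !lee_fin => r1 rs s1; have r0 : 0 < r by exact: lt_le_trans r1.
by rewrite !fine_invE ?gt_eqF ?(lt_le_trans r0)// lef_pV2// posrE (lt_le_trans r0).
Qed.

(** An exponent in [-1, 0] turns a factor a in the base into a factor of at most a. Thus bin counts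
    comparable with n / log n give comparable rates. *)
Lemma powR_npos_ratio (x y a b : R) : -1 <= b <= 0 -> 0 < x -> 0 < y -> 1 <= a ->
  y <= a * x -> x `^ b <= a * y `^ b.
Proof.
have [c ->] : exists c, b = - c by exists (- b); rewrite opprK.
rewrite lerN2 oppr_le0 andbC => c01 x0 y0 a1 yax.
have a0 : 0 < a by exact: lt_le_trans a1.
rewrite !powRN.
rewrite ler_pdivlMr ?powR_gt0// mulrC ler_pdivrMr ?powR_gt0//.
apply: (@le_trans _ _ ((a * x) `^ c)).
  apply: ge0_ler_powR => //; first by case/andP: c01.
  - by rewrite nnegrE ltW.
  - by rewrite nnegrE mulr_ge0// ltW.
rewrite powRM ?(ltW a0) ?(ltW x0)// ler_wpM2r ?powR_ge0// ler1_powR//.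
by case/andP: c01.
Qed.

(** Picking one sample in each occupied bin is injective, since the bins are disjoint. *)
Lemma card_occupied n m (x : 'I_n -> R) :
  (#|[set j : 'I_m | `[< exists i, bin m j (x i) >]]%SET| <= n)%N.
Proof.
set S := finset _; pose i0 (j : 'I_m) := [pick i : 'I_n | `[< bin m j (x i) >]].
have HS (j : 'I_m) : j \in S -> exists i, i0 j = Some i /\ bin m j (x i).
  rewrite inE => /asboolP[i ji]; rewrite /i0; case: pickP => [i' /asboolP ?|].
    by exists i'.
  by move=> /(_ i)/asboolP.
have [->|[j0 /HS[i1 _]]] := set_0Vmem S; first by rewrite cards0.
have injS : {in S &, injective (fun j => odflt i1 (i0 j))}.
  move=> j k /HS[i [-> ji]] /HS[l [-> kl]] /= il; apply/val_inj.
  by rewrite il in ji; exact: (bin_inj (leq_trans (ltn0Sn _) (ltn_ord j)) ji kl).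
by rewrite -(card_in_imset injS) -[leqRHS](card_ord n) max_card.
Qed.

(** Pigeonhole: n points leave one of n + 1 bins empty. *)
Lemma optimal_radius_ge p q n : (1 <= p)%E -> (p <= q)%E ->
  ((100^-1 * n.+1%:R `^ (-1 + fine p^-1%E - fine q^-1%E))%:E <=
    optimal_radius p q n)%E.
Proof.
move=> p1 pq; have q1 : (1 <= q)%E by exact: le_trans pq.
apply: le_ereal_inf_tmp => _ [x _ <-].
pose O := [set j : 'I_n.+1 | `[< exists i, bin n.+1 j (x i) >]]%SET.
have [j jO] : exists j, j \notin O.
  have [/existsP//|/existsPn H] := boolP [exists j, j \notin O].
  exfalso.
  have := card_occupied n.+1 x; rewrite -/O leqNgt => /negP; apply.
  rewrite (_ : O = finset.setT) ?cardsT ?card_ord//.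
  by apply/finset.setP => j; rewrite [in RHS]inE; exact/negPn/H.
have := @radius_ge_bins _ p q n n.+1 x [set j]%SET p1 q1.
have mR : 0 < n.+1%:R :> R by rewrite ltr0n.
have rhoE : n.+1%:R^-1 * (1 / n.+1%:R) `^ (fine q^-1%E - fine p^-1%E) =
    n.+1%:R `^ (-1 + fine p^-1%E - fine q^-1%E) :> R.
  rewrite div1r -{1}[n.+1%:R^-1]powR_inv1// -[n.+1%:R^-1]powR_inv1// -powRrM -powRD.
    by congr (_ `^ _); ring.
  by rewrite (gt_eqF mR) implybT.
rewrite cards1 -mulrA rhoE; apply.
  by apply/set0Pn; exists j; rewrite finset.inE.
move=> i k; rewrite inE => /eqP -> ji; move: jO; rewrite inE => /asboolP; apply.
by exists i.
Qed.

Lemma bin_centers n (i : 'I_n) :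
  bin n i ((i%:R + 2^-1) / n%:R : R) /\ (i%:R + 2^-1) / n%:R \in `[0 : R, 1].
Proof.
have n0 : (0 < n)%N by exact: leq_trans (ltn_ord i).
have H : bin n i ((i%:R + 2^-1) / n%:R : R).
  apply/binP => //; rewrite mulrC divfK ?pnatr_eq0 -?lt0n// -(natr1 i); lra.
split => //; have := bin01 (ltn_ord i) H; rewrite in_itv/=; lra.
Qed.

Lemma optimal_radius_le p q n : (0 < n)%N -> (1 <= p)%E -> (p <= q)%E ->
  (optimal_radius p q n <= (2 * n%:R `^ (-1 + fine p^-1%E - fine q^-1%E))%:E)%E.
Proof.
move=> n0 p1 pq; pose x (i : 'I_n) : R := (i%:R + 2^-1) / n%:R.
apply: ge_ereal_inf; exists (radius_of_information p q x).
  by exists x => // i; exact: (bin_centers i).2.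
by apply: radius_occupied => // j; exists j; exact: (bin_centers j).1.
Qed.

(** Of 2n bins at least n are empty, so mu >= 1/2, and the exponent 1/q - 1/p lies in [0, 1]. As
    this holds for all points, it bounds the optimal and the expected radius alike; 400 = 100 * 2 *
    2. *)
Lemma radius_ge_linear p q n (x : 'I_n -> R) : (0 < n)%N -> (1 <= q)%E -> (q <= p)%E ->
  ((400^-1 / n%:R)%:E <= radius_of_information p q x)%E.
Proof.
move=> n0 q1 qp; have p1 : (1 <= p)%E by exact: le_trans qp.
have nR : 0 < n%:R :> R by rewrite ltr0n.
pose O := [set j : 'I_(n + n) | `[< exists i, bin (n + n) j (x i) >]]%SET.
have cO := card_occupied (n + n) x; rewrite -/O in cO.
have cC : (n <= #|finset.setC O|)%N.
  by rewrite cardsCs finset.setCK card_ord; move: cO; lia.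
have cm : (#|finset.setC O| <= n + n)%N by rewrite -[leqRHS](card_ord (n + n)) max_card.
apply: le_trans (@radius_ge_bins _ p q n (n + n) x (finset.setC O) p1 q1 _ _); last 2 first.
- by rewrite -card_gt0 (leq_trans _ cC).
- move=> i j; rewrite !inE => /asboolP nj ji; apply: nj; by exists i.
set mu := #|_|%:R / _; set g := fine _ - _.
have nn : (n + n)%:R = 2 * n%:R :> R by rewrite natrD; ring.
have mu1 : 2^-1 <= mu <= 1.
  rewrite /mu nn ler_pdivlMr ?mulr_gt0// mulrA mulVf// mul1r ler_nat cC/=.
  by rewrite ler_pdivrMr ?mulr_gt0// mul1r -nn ler_nat.
have g01 : 0 <= g <= 1.
  have := fine_inve01 p1; have := fine_inve01 q1; have := fine_inve_le q1 qp.
  by rewrite /g => ? /andP[? ?] /andP[? ?]; apply/andP; split; lra.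
have : 2^-1 <= mu `^ g.
  case/andP: mu1 => mu1 mu2; apply: (le_trans mu1).
  by rewrite ger1_powR ?mu2 ?andbT//; [lra|case/andP: g01].
rewrite lee_fin nn => H.
rewrite (_ : 400^-1 / n%:R = 100^-1 / (2 * n%:R) * 2^-1); last by field; rewrite gt_eqF.
by rewrite ler_wpM2l// divr_ge0// mulr_ge0.
Qed.

Lemma optimal_radius_le_linear p q n : (0 < n)%N -> (1 <= q)%E -> (q < p)%E ->
  (optimal_radius p q n <= (10 / n%:R)%:E)%E.
Proof.
move=> n0; case: q => [s| |//]; last by move=> _; rewrite ltNge leey.
rewrite lee_fin => s1 sp.
have nR : (0 < n%:R :> R) by rewrite ltr0n.
pose x (i : 'I_n) : R := (i%:R + 2^-1) / n%:R.
apply: ge_ereal_inf; exists (radius_of_information p s%:E x).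
  by exists x => // i; exact: (bin_centers i).2.
have [r sr pr] : exists2 r : R, s < r & p = r%:E \/ p = +oo%E.
  case: p sp => [r| _|//]; first by rewrite lte_fin => sr; exists r => //; left.
  by exists (s + 1); [lra|right].
(* With samples at the bin centres all distances are 0, and the bound is 2/n * (4 + 1). *)
apply: le_trans (@radius_nearest _ p s n n x r (fun=> 0%N) id n0 s1 sr pr _ _) _.
- by move=> j; exists j; exact: (bin_centers j).1.
- by move=> j; rewrite /dist subnn.
rewrite lee_fin (eq_bigr (fun=> 1)); last by move=> j _; rewrite powR1.
rewrite sumr_const card_ord mulVf ?gt_eqF// le_eqVlt; apply/orP; left; apply/eqP.
by field; rewrite gt_eqF.
Qed.

End rates.

(** * The rates *)

Section logarithmic_rate.
Context {R : realType}.

Lemma between_multiples_scaled (c C rho a1 a2 b1 b2 : R) (a b : \bar R) :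
  0 <= rho -> [/\ 0 <= c, 0 <= C, c * b2 <= a1 & a2 <= C * b1] ->
  ((a1 * rho)%:E <= a)%E -> (a <= (a2 * rho)%:E)%E ->
  ((b1 * rho)%:E <= b)%E -> (b <= (b2 * rho)%:E)%E -> between_multiples c C a b.
Proof.
move=> r0 [c0 C0 h1 h2]; case: b => [b| |]; last 2 first.
- by move=> _ _ _; rewrite leNgt ltry.
- by move=> _ _; rewrite leNgt ltNyr.
move=> la au; rewrite !lee_fin => lb bu; split.
  apply: le_trans la; rewrite -EFinM lee_fin.
  by apply: (le_trans (ler_wpM2l c0 bu)); rewrite mulrA ler_wpM2r.
apply: (le_trans au); rewrite -EFinM lee_fin.
by apply: le_trans (ler_wpM2l C0 lb); rewrite mulrA ler_wpM2r.
Qed.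

(** From 1 + x <= exp x at x = -t and at x = t/2, where t = ln n; the latter gives n >= (1 + t/2)^2
    >= 2t. *)
Lemma ln_nat_bounds n : (2 <= n)%N ->
  2^-1 <= ln n%:R :> R /\ ln n%:R <= n%:R / 2 :> R.
Proof.
move=> n2; have nR : 2 <= n%:R :> R by rewrite ler_nat.
have n0 : 0 < n%:R :> R by lra.
have nE : expR (ln n%:R) = n%:R :> R by rewrite lnK.
set t := ln n%:R in nE *; split.
  have := expR_ge1Dx (- t); rewrite expRN nE.
  have : n%:R^-1 <= 2^-1 :> R by rewrite lef_pV2// posrE.
  lra.
have := expR_ge1Dx (t / 2) => h.
have e2 : expR t = expR (t / 2) ^+ 2 by rewrite -expRM_natr divfK.
have [t0|t0] := lerP t 0; first by lra.
have := sqr_ge0 (1 - t / 2); rewrite -nE e2; nra.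
Qed.

Lemma nat_div_ln_bounds n : (2 <= n)%N ->
  2 <= (n%:R / ln n%:R : R) <= 2 * n%:R.
Proof.
move=> n2; have [l1 l2] := ln_nat_bounds n2.
have l0 : 0 < ln n%:R :> R by lra.
have n0 : 0 <= n%:R :> R by [].
by rewrite ler_pdivlMr// ler_pdivrMr//; apply/andP; split; nra.
Qed.

(** With L = n / ln n and m = floor(L / 2) one has n/m >= 2 ln n, so a given bin is empty with
    probability at most n^(-2). The expected number of empty bins is at most L / (2 n^2) <= 2 / L
    because L <= 2n. *)
Lemma coarse_bins n : (2 <= n)%N -> exists m : nat, [/\ (0 < m)%N,
  n%:R / ln n%:R <= 4 * m%:R :> R &
  m%:R * (1 - m%:R^-1) ^+ n <= 2 / (n%:R / ln n%:R) :> R].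
Proof.
move=> n2; have [l1 l2] := ln_nat_bounds n2.
have /andP[L2 L2n] := nat_div_ln_bounds n2.
have l0 : 0 < ln n%:R :> R by lra.
have n0 : 0 < n%:R :> R by rewrite ltr0n (leq_trans _ n2).
set L := n%:R / ln n%:R in L2 L2n *.
have L0 : 0 < L by lra.
pose m := Num.truncn (L / 2).
have /andP[m1 m2] : m%:R <= L / 2 < m.+1%:R.
  by apply: truncn_itv; rewrite divr_ge0// ltW.
rewrite -(natr1 m) in m2.
have m0 : (0 < m)%N by rewrite /m truncn_gt0 ler_pdivlMr// mul1r.
have mR : 1 <= m%:R :> R by rewrite ler1n.
exists m; split => //; first by lra.
have H : (1 - m%:R^-1) ^+ n <= n%:R^-1 ^+ 2 :> R.
  apply: (le_trans (onem_le_expR n _)); first by rewrite invf_le1//; lra.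
  rewrite -[n%:R^-1](@lnK _ (n%:R^-1)) ?posrE ?invr_gt0//.
  rewrite -expRM_natr ler_expR lnV ?posrE// mulNr lerN2.
  rewrite [leRHS]mulrC ler_pdivlMr; last by lra.
  have nL : n%:R = L * ln n%:R :> R by rewrite /L divfK// gt_eqF.
  by rewrite [leRHS]nL -mulrA mulrC ler_wpM2r ?(ltW l0)//; lra.
apply: (@le_trans _ _ (L / 2 * n%:R^-1 ^+ 2)).
  apply: ler_pM => //; rewrite exprn_ge0// subr_ge0 invf_le1//; lra.
rewrite ler_pdivlMr//.
have -> : L / 2 * n%:R^-1 ^+ 2 * L = 2^-1 * (L / n%:R) ^+ 2 by field; rewrite gt_eqF.
have : L / n%:R <= 2 by rewrite ler_pdivrMr.
have : 0 <= L / n%:R by rewrite divr_ge0 ?ltW.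
by move=> h1 h2; nra.
Qed.

Lemma expR_le_onem (y : R) : 0 <= y <= 2^-1 -> expR (- (2 * y)) <= 1 - y.
Proof.
move=> /andP[y0 y1]; have := expR_ge1Dx (2 * y) => h.
rewrite expRN -[1 - y]invrK lef_pV2 ?posrE ?expR_gt0 ?invr_gt0//; last by lra.
apply: le_trans h; rewrite -[leLHS]div1r ler_pdivrMr; last by lra.
nra.
Qed.

(** For m just above 4 L, the bound 1 - 1/m >= exp(-2/m) makes a given bin empty with probability at
    least exp(-(ln n) / 2) = n^(-1/2). The expected number of empty bins is then at least 4 L
    n^(-1/2), which is at least 1 since ln n <= 2 n^(1/2). *)
Lemma fine_bins n : (2 <= n)%N -> exists m : nat, [/\ (1 < m)%N,
  m%:R <= 5 * (n%:R / ln n%:R) :> R &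
  1 <= m%:R * (1 - m%:R^-1) ^+ n :> R].
Proof.
move=> n2; have [l1 l2] := ln_nat_bounds n2.
have /andP[L2 L2n] := nat_div_ln_bounds n2.
have l0 : 0 < ln n%:R :> R by lra.
have n0 : 0 < n%:R :> R by rewrite ltr0n (leq_trans _ n2).
set L := n%:R / ln n%:R in L2 L2n *.
have L0 : 0 < L by lra.
have nL : n%:R = L * ln n%:R :> R by rewrite /L divfK// gt_eqF.
pose m := (Num.truncn (4 * L)).+1.
have [m1 m2] : m%:R <= 4 * L + 1 /\ 4 * L <= m%:R.
  have /andP[a b] : (Num.truncn (4 * L))%:R <= 4 * L < m%:R.
    by apply: truncn_itv; rewrite mulr_ge0// ltW.
  split; last exact: ltW b.
  by rewrite /m -(natr1 (Num.truncn _)); lra.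
have mR : 2 <= m%:R :> R by lra.
have m0 : 0 < m%:R :> R by lra.
exists m; split; first by rewrite -(ltr_nat R); lra.
  by lra.
have y01 : 0 <= (m%:R^-1 : R) <= 2^-1 by rewrite invr_ge0 ltW//= lef_pV2// posrE.
have H : expR (- (ln n%:R / 2)) <= (1 - m%:R^-1) ^+ n :> R.
  apply: (@le_trans _ _ (expR (- (2 * m%:R^-1)) ^+ n)).
    rewrite -expRM_natr ler_expR mulNr lerN2 mulrAC ler_pdivrMr// [X in _ * X <= _]nL.
    by have := ler_wpM2l (ltW l0) m2; lra.
  by rewrite lerXn2r ?nnegrE ?expR_ge0 ?expR_le_onem// subr_ge0; lra.
apply: (@le_trans _ _ (4 * L * expR (- (ln n%:R / 2)))); last first.
  by apply: ler_pM => //; rewrite ?expR_ge0// mulr_ge0// ltW.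
rewrite expRN ler_pdivlMr ?expR_gt0// mul1r.
set e := expR _; have eE : n%:R = e ^+ 2 by rewrite /e -expRM_natr divfK// lnK.
have he : ln n%:R / 2 <= e by have := expR_ge1Dx (ln n%:R / 2 : R); rewrite -/e; lra.
have e0 : 0 < e by exact: expR_gt0.
rewrite /L mulrA ler_pdivlMr// [X in _ <= _ * X]eE.
by have := ler_wpM2l (ltW e0) he; have := mulr_gt0 e0 e0; lra.
Qed.

End logarithmic_rate.

Theorem theorem1 (R : realType) (p q : \bar R)
    (hp : (1 <= p)%E) (hq : (1 <= q)%E) :
  ((q < p)%E ->
   exists c C : R, [/\ 0 < c, 0 < C &
     forall n : nat, (2 <= n)%N ->
       (forall (d : measure_display) (T : measurableType d)
          (P : probability T R) (X : 'I_n -> {RV P >-> R}),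
          iid_uniform X ->
          between_multiples c C (expected_radius p q X)
            (optimal_radius p q n)) /\
       between_multiples c C (optimal_radius p q n) (n%:R^-1)%:E]) /\
  ((p <= q)%E ->
   exists c C : R, [/\ 0 < c, 0 < C &
     forall n : nat, (2 <= n)%N ->
       (forall (d : measure_display) (T : measurableType d)
          (P : probability T R) (X : 'I_n -> {RV P >-> R}),
          iid_uniform X ->
          between_multiples c C (expected_radius p q X)
            (optimal_radius p q (Num.truncn (n%:R / ln n%:R : R)))) /\
       between_multiples c C
         (optimal_radius p q (Num.truncn (n%:R / ln n%:R : R)))
         ((n%:R / ln n%:R) `^ (-1 + fine p^-1%E - fine q^-1%E))%:E]).
Proof.
Proof.
split=> [qp|pq].
  have p1 := hp; have [s sE] : exists s, q = s%:E.
    by case: (q) hq qp => [s _ _|_|//]; [exists s|rewrite ltNge leey].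
  subst q; have s1 : 1 <= s by rewrite -lee_fin.
  have [r sr pr] : exists2 r : R, s < r & p = r%:E \/ p = +oo%E.
    case: p {hp p1} qp => [r| _|//]; first by rewrite lte_fin => sr; exists r => //; left.
    by exists (s + 1); [lra|right].
  have [C0 C00 HC] := sum_powR_exp_le (near_exponent_ge1 s1 sr).
  (* Ratios of the constants in front of 1/n: 1/400 over 10 from below, 8 + 2 C0 over 1/400 from
     above. *)
  exists 4000^-1, (400 * (8 + 2 * C0) + 10); split; [lra|lra|] => n n2.
  have n0 : (0 < n)%N by exact: leq_trans n2.
  have nI : 0 <= n%:R^-1 :> R by rewrite invr_ge0.
  have ole := optimal_radius_le_linear n0 hq qp.
  have oge : ((400^-1 / n%:R)%:E <= optimal_radius p s%:E n)%E.
    apply: le_ereal_inf_tmp => _ [x _ <-].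
    by apply: radius_ge_linear => //; exact: ltW.
  split=> [d T P X hX|].
    apply: (@between_multiples_scaled _ _ _ n%:R^-1 400^-1 (8 + 2 * C0) 400^-1 10 _ _ nI);
      [by split; lra| | |exact: oge|exact: ole].
    - by apply: expected_radius_ge => // x; apply: radius_ge_linear => //; exact: ltW.
    - exact: (expected_radius_nearest hX p1 s1 sr pr n0).
  by apply: (@between_multiples_scaled _ _ _ n%:R^-1 400^-1 10 1 1 _ _ nI);
    [split; lra|exact: oge|exact: ole|rewrite mul1r|rewrite mul1r].
(* Again ratios: 1/1000 over 4 from below, 16 over 1/200 from above. *)
exists 4000^-1, 3200; split; [lra|lra|] => n n2.
set L : R := n%:R / ln n%:R; set b := -1 + fine p^-1%E - fine q^-1%E.
have /andP[L2 L2n] : 2 <= L <= 2 * n%:R := nat_div_ln_bounds n2.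
have L0 : 0 < L by lra.
have b01 : -1 <= b <= 0.
  have := fine_inve01 hp; have := fine_inve01 hq; have := fine_inve_le hp pq.
  by rewrite /b => ? /andP[? ?] /andP[? ?]; apply/andP; split; lra.
have rho0 : 0 <= L `^ b by exact: powR_ge0.
set k := Num.truncn L.
(* Since L >= 2, rounding costs at most a factor 2: L <= k + 1 <= 2 k and k + 1 <= 2 L. *)
have /andP[k1 k2] : k%:R <= L < k.+1%:R by apply: truncn_itv; exact: ltW.
have k0 : (0 < k)%N by rewrite truncn_gt0; lra.
have kR : 1 <= k%:R :> R by rewrite ler1n.
have k2' : L <= k%:R + 1 by rewrite natr1 ltW.
have ole : (optimal_radius p q k <= (4 * L `^ b)%:E)%E.
  apply: le_trans (optimal_radius_le k0 hp pq) _; rewrite lee_fin -/b.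
  have : k%:R `^ b <= 2 * L `^ b by apply: powR_npos_ratio; [exact: b01|lra..].
  lra.
have oge : ((200^-1 * L `^ b)%:E <= optimal_radius p q k)%E.
  apply: le_trans (optimal_radius_ge k hp pq); rewrite lee_fin -/b.
  have : L `^ b <= 2 * k.+1%:R `^ b.
    have kS : k.+1%:R = k%:R + 1 :> R by rewrite natr1.
    by apply: powR_npos_ratio; [exact: b01|lra..].
  lra.
split=> [d T P X hX|]; last first.
  by apply: (@between_multiples_scaled _ _ _ (L `^ b) 200^-1 4 1 1 _ _ rho0);
    [split; lra|exact: oge|exact: ole|rewrite mul1r|rewrite mul1r].
apply: (@between_multiples_scaled _ _ _ (L `^ b) 1000^-1 16 200^-1 4 _ _ rho0);
  [by split; lra| | |exact: oge|exact: ole].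
- have [m [m1 mL um]] := @fine_bins R n n2; rewrite -/L in mL.
  apply: (le_trans _ (expected_radius_some_miss hX hp hq m1 um)).
  rewrite lee_fin -/b.
  have : L `^ b <= 5 * m%:R `^ b.
    have m0 : 0 < m%:R :> R by rewrite ltr0n (ltn_trans _ m1).
    by apply: powR_npos_ratio; [exact: b01|lra..].
  lra.
- have [m [m0 Lm um]] := @coarse_bins R n n2; rewrite -/L in Lm um.
  apply: le_trans (expected_radius_occupied hX hp hq m0 pq) _.
  rewrite lee_fin -/b.
  have : m%:R `^ b <= 4 * L `^ b.
    have mR : 0 < m%:R :> R by rewrite ltr0n.
    by apply: powR_npos_ratio; [exact: b01|lra..].
  (* Empty bins contribute 4 * 2 / L, absorbed by the rate because b >= -1 and L >= 1; together with
     2 * 4 from the occupied case this gives 16. *)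
  have : L^-1 <= L `^ b.
    by rewrite -powR_inv1 ?(ltW L0)// ler_powR//; [lra|case/andP: b01].
  lra.
Qed.
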